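(* Let $\mathfrak g$ be a complex semisimple Lie algebra and $\mathfrak p\subset\mathfrak g$ a parabolic subalgebra. If $-\mu$ is a $\mathfrak p$-dominant weight and $\mathfrak a:=\mathfrak a(\mu)=\bigoplus_k\mathfrak a_k$, then: (a) $\mathfrak a_k$ is a direct sum of root spaces, for all $k>0$. (b) $\Delta(\mathfrak a_1)=\bigcup_{i\in I_\mu}\Delta(\mathfrak g_{1_i,\mathbf 0})$. In particular, $I_\mu=\emptyset$ if and only if $\mathfrak a_+=0$, where $\mathfrak a_+=\bigoplus_{k>0}\mathfrak a_k$. (c) If $I_\mu\ne\emptyset$, then $\mathfrak a_1$ is bracket-generating in $\mathfrak a_+$ (i.e. generates $\mathfrak a_+$ as a Lie algebra), and $$\Delta(\mathfrak a_k)=\{\alpha\in\Delta(\mathfrak g_k) : Z_{I_\mu}(\alpha)=k,\ Z_{J_\mu}(\alpha)=0\},\qquad k\ge1.$$ In particular, for all $\alpha\in\Delta(\mathfrak a_k)$ we have $Z_j(\alpha)=0$ for all $j\in(I_{\mathfrak p}\setminus I_\mu)\cup J_\mu$.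
   Context: Fix a Cartan subalgebra $\mathfrak h$ and a Borel subalgebra $\mathfrak b$ with $\mathfrak h\subset\mathfrak b\subset\mathfrak p$; $\Delta$ is the root system, $\alpha_1,\dots,\alpha_\ell$ the simple roots, $\alpha^\vee=2\alpha/\langle\alpha,\alpha\rangle$, $\{Z_i\}\subset\mathfrak h$ the basis dual to $\{\alpha_i\}$, and $Z_S=\sum_{i\in S}Z_i$ for $S\subset\{1,\dots,\ell\}$ (so $Z_S(\alpha):=\alpha(Z_S)$). For a subspace $U\subset\mathfrak g$ that is a sum of root spaces and possibly a subspace of $\mathfrak h$, $\Delta(U)$ is its set of roots. $I_{\mathfrak p}=\{i:\mathfrak g_{-\alpha_i}\not\subseteq\mathfrak p\}$. The grading $\mathfrak g=\bigoplus_j\mathfrak g_j$ is by eigenvalues of $\mathrm{ad}\,Z$ with $Z=Z_{I_{\mathfrak p}}$, so $\mathfrak p=\mathfrak g_{\ge0}$, $\mathfrak g_-=\mathfrak g_{<0}$. It is assumed that no simple ideal of $\mathfrak g$ is contained in $\mathfrak g_0$. $-\mu\in\mathfrak h^*$ is $\mathfrak p$-dominant if $\langle-\mu,\alpha_i^\vee\rangle\in\mathbb Z_{\ge0}$ for all $i\notin I_{\mathfrak p}$. $\mathbb V_\mu$ is the irreducible $\mathfrak g_0$-module with lowest weight $\mu$. $$J_\mu=\{j\notin I_{\mathfrak p}:\langle\mu,\alpha_j^\vee\rangle\ne0\},\qquad I_\mu=\{j\in I_{\mathfrak p}:\langle\mu,\alpha_j^\vee\rangle=0\}.$$ For $i\in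 I_{\mathfrak p}$, $\Delta(\mathfrak g_{1_i,\mathbf 0})=\{\alpha\in\Delta(\mathfrak g_1):Z_i(\alpha)=1 \text{ and } Z_j(\alpha)=0\ \forall j\in J_\mu\}$. For a subalgebra $\mathfrak a_0\subset\mathfrak g_0$, $\mathrm{pr}^{\mathfrak g}(\mathfrak g_-,\mathfrak a_0)=\bigoplus_i\mathfrak a_i$ with $\mathfrak a_i=\mathfrak g_i$ for $i<0$, the given $\mathfrak a_0$ in degree $0$, and $\mathfrak a_i=\{X\in\mathfrak g_i:[X,\mathfrak g_{-1}]\subseteq\mathfrak a_{i-1}\}$ for $i>0$. $\mathfrak a(\mu)=\mathrm{pr}^{\mathfrak g}(\mathfrak g_-,\mathfrak{ann}(\phi_0))$, where $\phi_0$ is a lowest weight vector of $\mathbb V_\mu$ and $\mathfrak{ann}(\phi_0)\subset\mathfrak g_0$ its annihilator. *)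

(* Defs.v *)
From HB Require Import structures.
From mathcomp Require Import all_boot all_order all_algebra.
From mathcomp Require Import complex.
From mathcomp Require Import classical_sets reals.
Set Implicit Arguments.
Unset Strict Implicit.
Unset Printing Implicit Defensive.
Import Order.TTheory GRing.Theory Num.Theory.
Local Open Scope ring_scope.

Lemma linear_lfunE (F : fieldType) (U V : vectType F) (f : U -> V) x :
  linear f -> linfun f x = f x.
Proof.
move=> lin; pose f' := HB.pack_for {linear U -> V} f
  (GRing.isLinear.Build F U V *:%R f lin).
exact: (lfunE f').
Qed.

HB.mixin Record Vector_isLieAlgebra (F : fieldType) L of Vector F L := {
  lie : L -> L -> L;
  lie_linearl : forall y, linear (fun x => lie x y);
  lie_linearr : forall x, linear (lie x);
  liexx : forall x, lie x x = 0;
  jacobi : forall x y z,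
    lie x (lie y z) + lie y (lie z x) + lie z (lie x y) = 0
}.

#[short(type="lieAlgType")]
HB.structure Definition LieAlgebra (F : fieldType) :=
  { L of Vector_isLieAlgebra F L & Vector F L }.

Section LieAlgebraTheory.
Variables (F : fieldType) (g : lieAlgType F).
Implicit Types (x y : g) (U V W : {vspace g}).

HB.instance Definition _ x :=
  GRing.isLinear.Build F g g *:%R (lie x) (lie_linearr x).

Definition ad x : 'End(g) := linfun (lie x).

Lemma memv_leigenspace (f : 'End(g)) a x :
  reflect (f x = a *: x) (x \in passmx.leigenspace f a).
Proof.
rewrite memv_ker add_lfunE opp_lfunE scale_lfunE id_lfunE subr_eq0.
exact: eqP.
Qed.

Lemma adE x y : ad x y = lie x y.
Proof. by rewrite lfunE. Qed.

Lemma lieDl x1 x2 y : lie (x1 + x2) y = lie x1 y + lie x2 y.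
Proof. by have := lie_linearl y 1 x1 x2; rewrite !scale1r. Qed.

Lemma lieC x y : lie x y = - lie y x.
Proof.
apply/eqP; rewrite -addr_eq0; apply/eqP.
have := liexx (x + y); rewrite lieDl !linearD /= !liexx addr0 add0r.
by [].
Qed.

(* The span of all brackets of an element of U with an element of V. *)
Definition liev U V : {vspace g} :=
  <<[seq lie x y | x <- vbasis U, y <- vbasis V]>>%VS.

Lemma liev_subP U V W :
  reflect (forall x y, x \in U -> y \in V -> lie x y \in W)
          (liev U V <= W)%VS.
Proof.
apply: (iffP span_subvP) => [sW x y Ux Vy | sW _ /allpairsP[[x y] /= [Ux Vy ->]]].
  rewrite (coord_vbasis Vy) linear_sum rpred_sum // => j _.
  rewrite linearZ rpredZ //= lieC rpredN.
  rewrite (coord_vbasis Ux) linear_sum rpred_sum // => i _.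
  rewrite linearZ rpredZ //= lieC rpredN sW //.
  by apply: allpairs_f; apply: mem_nth; rewrite size_tuple.
by apply: sW; apply: vbasis_mem.
Qed.

(* The space of all x with [x, U] included in W. *)
Definition transporter U W : {vspace g} :=
  (\bigcap_(i < \dim U) (ad (vbasis U)`_i @^-1: W))%VS.

Lemma memv_transporter U W x :
  reflect (forall y, y \in U -> lie x y \in W) (x \in transporter U W).
Proof.
rewrite /transporter memvE.
apply: (iffP subv_bigcapP) => [xW y Uy | xW i _].
  rewrite (coord_vbasis Uy) linear_sum rpred_sum // => i _.
  rewrite linearZ rpredZ //= lieC rpredN -adE memv_preim memvE.
  exact: xW.
by rewrite -memvE -memv_preim adE lieC rpredN xW // vbasis_mem // mem_nth // size_tuple.
Qed.

Definition is_subalgebra U := forall x y, x \in U -> y \in U -> lie x y \in U.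
Definition is_ideal U := forall x y, y \in U -> lie x y \in U.
Definition is_abelian U := forall x y, x \in U -> y \in U -> lie x y = 0.

Fixpoint derived_series U (n : nat) : {vspace g} :=
  if n is n'.+1 then liev (derived_series U n') (derived_series U n') else U.

Definition is_solvable U := exists n, derived_series U n = 0%VS.

Definition is_semisimple := forall U, is_ideal U -> is_solvable U -> U = 0%VS.

Definition is_simple_ideal U :=
  [/\ is_ideal U, ~ is_abelian U
    & forall V, (V <= U)%VS -> (forall x y, x \in U -> y \in V -> lie x y \in V) ->
      V = 0%VS \/ V = U].

Definition is_diagonalizable (f : 'End(g)) :=
  exists e : (\dim {:g}).-tuple g,
    basis_of fullv e /\ forall i, exists a, f (tnth e i) = a *: tnth e i.

(* Cartan subalgebra of a complex semisimple Lie algebra: abelian, equal to its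
   own centralizer, and acting on g by diagonalizable endomorphisms. *)
Definition is_cartan U :=
  [/\ is_abelian U,
      forall x, (forall y, y \in U -> lie x y = 0) -> x \in U
    & forall x, x \in U -> is_diagonalizable (ad x)].

Definition is_borel U :=
  [/\ is_subalgebra U, is_solvable U
    & forall V, is_subalgebra V -> is_solvable V -> (U <= V)%VS -> V = U].

Definition is_parabolic U :=
  is_subalgebra U /\ exists2 V, is_borel V & (V <= U)%VS.

Definition lftrace (f : 'End(g)) : F :=
  \sum_(i < \dim {:g}) coord (vbasis {:g}) i (f (vbasis {:g})`_i).

Definition killing x y : F := lftrace (ad x \o ad y)%VF.

Definition lie_gen (A : set g) : set g :=
  [set x | forall U, is_subalgebra U -> (A `<=` [set` U])%classic -> x \in U].

Lemma lftraceD f1 f2 : lftrace (f1 + f2) = lftrace f1 + lftrace f2.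
Proof.
by rewrite /lftrace -big_split; apply: eq_bigr => i _; rewrite add_lfunE linearD.
Qed.

Lemma lftraceZ a f : lftrace (a *: f) = a * lftrace f.
Proof.
rewrite /lftrace mulr_sumr; apply: eq_bigr => i _.
by rewrite scale_lfunE linearZ.
Qed.

Lemma ad_linear : linear ad.
Proof. by move=> a x y; apply/lfunP => z; rewrite add_lfunE scale_lfunE !adE lie_linearl. Qed.

Lemma killing_linearr x : linear (killing x : g -> F^o).
Proof.
by move=> a y z; rewrite /killing ad_linear comp_lfunDr -comp_lfunZr lftraceD lftraceZ.
Qed.

Lemma killing_linearl y : linear (killing^~ y : g -> F^o).
Proof.
by move=> a x z; rewrite /killing ad_linear comp_lfunDl -comp_lfunZl lftraceD lftraceZ.
Qed.

HB.instance Definition _ x :=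
  GRing.isLinear.Build F g F^o *:%R (killing x : g -> F^o) (killing_linearr x).

(* Prolongation in g of a subspace a0 of the degree-0 component of a grading. *)
Fixpoint prolong_nat (gr : int -> {vspace g}) (a0 : {vspace g}) (n : nat) :=
  if n is n'.+1 then
    (gr n'.+1 :&: transporter (gr (-1)) (prolong_nat gr a0 n'))%VS
  else a0.

Definition prolong (gr : int -> {vspace g}) (a0 : {vspace g}) (i : int) :=
  if i is Posz n then prolong_nat gr a0 n else gr i.

(* Each element of the direct sum of the a k, k > 0, lies in a finite partial sum. *)
Definition positive_part (a : int -> {vspace g}) : set g :=
  [set x | exists n, x \in (\sum_(1 <= k < n) a k)%VS].

End LieAlgebraTheory.

Arguments is_semisimple {F} g.

Section Roots.
Variables (F : fieldType) (g : lieAlgType F) (h : {vspace g}).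

Definition dual := 'Hom(subvs_of h, F^o).

Implicit Types (alpha beta lambda : dual) (U : {vspace g}).

Definition root_space alpha : {vspace g} :=
  (\bigcap_(i < \dim h)
     passmx.leigenspace (ad (vbasis h)`_i) (alpha (vsproj h (vbasis h)`_i)))%VS.

Lemma memv_root_space alpha x :
  reflect (forall H : subvs_of h, lie (vsval H) x = (alpha H : F) *: x)
          (x \in root_space alpha).
Proof.
rewrite memvE; apply: (iffP subv_bigcapP) => [xa H | xa i _].
  have e j : lie x (vbasis h)`_j = - (alpha (vsproj h (vbasis h)`_j) : F) *: x.
    have [jh|jh] := ltnP j (\dim h); last first.
      by rewrite nth_default ?size_tuple // linear0 linear0 linear0 oppr0 scale0r.
    have := xa (Ordinal jh) isT; rewrite -memvE => /memv_leigenspace.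
    by rewrite adE /= lieC scaleNr => <-; rewrite opprK.
  pose c i := coord (vbasis h) i (vsval H).
  have eH : vsval H = \sum_i c i *: (vbasis h)`_i by exact/coord_vbasis/subvsP.
  have aH : alpha H = \sum_i (c i : F) * alpha (vsproj h (vbasis h)`_i) :> F.
    have -> : H = \sum_i c i *: vsproj h (vbasis h)`_i.
      apply: val_inj; rewrite /= {1}eH linear_sum; apply: eq_bigr => i _.
      by rewrite linearZ /= vsprojK // vbasis_mem // mem_nth // size_tuple.
    by rewrite linear_sum; apply: eq_bigr => i _; rewrite linearZ.
  rewrite lieC eH linear_sum -sumrN aH scaler_suml; apply: eq_bigr => i _.
  by rewrite linearZ /= e scaleNr scalerN opprK scalerA.
rewrite -memvE; apply/memv_leigenspace; rewrite adE -xa vsprojK //.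
by rewrite vbasis_mem // mem_nth // size_tuple.
Qed.

Definition is_root alpha := alpha != 0 /\ root_space alpha != 0%VS.

(* Delta(U), for U a sum of root spaces and possibly of a subspace of h. *)
Definition roots_of U : set dual :=
  [set alpha | is_root alpha /\ (root_space alpha <= U)%VS].

(* The map h -> h^* given by the Killing form; the element of h representing
   lambda is obtained by inverting it, and this transports the Killing form of
   h to the form <.,.> on h^*. *)
Definition killing_map : 'Hom(subvs_of h, dual) :=
  linfun (fun H : subvs_of h =>
    linfun (fun H' : subvs_of h => killing (vsval H) (vsval H') : F^o) : dual).

Lemma killing_mapE H H' : (killing_map H : dual) H' = killing (vsval H) (vsval H').
Proof.
have klr (K : subvs_of h) :
    linear (fun H' : subvs_of h => killing (vsval K) (vsval H') : F^o).
  by move=> a x y; rewrite -killing_linearr -linearP.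
rewrite /killing_map linear_lfunE ?linear_lfunE // => a x y.
apply/lfunP => z; rewrite add_lfunE scale_lfunE !linear_lfunE //.
by rewrite -(killing_linearl _ a) -linearP.
Qed.

Definition dual_form lambda beta : F :=
  killing (vsval ((killing_map^-1)%VF lambda)) (vsval ((killing_map^-1)%VF beta)).

Definition coroot alpha : dual := (2 / dual_form alpha alpha) *: alpha.

Variables (b p : {vspace g}) (l : nat) (alpha : 'I_l -> dual)
  (Z : 'I_l -> subvs_of h).

(* alpha is the base of the root system whose set of positive roots is
   Delta(b). *)
Definition is_simple_system :=
  [/\ basis_of {:dual} [tuple alpha i | i < l],
      forall i, roots_of b (alpha i),
      forall beta, roots_of b beta ->
        exists n : 'I_l -> nat, beta = \sum_i alpha i *+ n i
    & forall beta, is_root beta -> ~ roots_of b beta ->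
        exists n : 'I_l -> nat, beta = - \sum_i alpha i *+ n i].

Definition is_dual_basis :=
  basis_of {:subvs_of h} [tuple Z i | i < l] /\
  forall i j, alpha i (Z j) = (i == j)%:R.

Definition ZS (S : {set 'I_l}) : subvs_of h := \sum_(i in S) Z i.

Definition Ip : {set 'I_l} := [set i | ~~ (root_space (- alpha i) <= p)%VS].

Definition grade (j : int) : {vspace g} :=
  passmx.leigenspace (ad (vsval (ZS Ip))) j%:~R.

Definition is_p_dominant lambda :=
  forall i, i \notin Ip -> exists n : nat, dual_form lambda (coroot (alpha i)) = n%:R.

Definition Jmu (mu : dual) : {set 'I_l} :=
  [set j | (j \notin Ip) && (dual_form mu (coroot (alpha j)) != 0)].

Definition Imu (mu : dual) : {set 'I_l} :=
  [set j | (j \in Ip) && (dual_form mu (coroot (alpha j)) == 0)].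

(* The roots beta of g_1 with Z_i(beta) = 1 and Z_j(beta) = 0 for j in J_mu. *)
Definition roots_1i0 (mu : dual) (i : 'I_l) : set dual :=
  [set beta | [/\ roots_of (grade 1) beta, beta (Z i) = 1
                & forall j, j \in Jmu mu -> beta (Z j) = 0]].

End Roots.

Section Modules.
Variables (F : fieldType) (g : lieAlgType F) (s : {vspace g}) (V : vectType F).
Variable rho : 'Hom(subvs_of s, 'End(V)).

(* vsproj s x is x itself, seen in the subtype, when x is in s; here s is a
   subalgebra. *)
Definition is_representation :=
  forall x y : subvs_of s,
    rho (vsproj s (lie (vsval x) (vsval y))) =
    (rho x \o rho y)%VF - (rho y \o rho x)%VF.

Definition is_irreducible :=
  {:V}%VS != 0%VS /\
  forall U : {vspace V}, (forall x, (rho x @: U <= U)%VS) ->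
    U = 0%VS \/ U = fullv.

(* The weight of phi is mu, and phi is killed by the negative root vectors of s. *)
Definition is_lowest_weight_vector (h b : {vspace g}) (mu : dual h) (phi : V) :=
  [/\ phi != 0,
      forall H : subvs_of h, rho (vsproj s (vsval H)) phi = (mu H : F) *: phi
    & forall (beta : dual h) x, roots_of b beta ->
        x \in root_space (- beta) -> x \in s -> rho (vsproj s x) phi = 0].

Definition ann (phi : V) : {vspace g} :=
  (linfun vsval @: lker (linfun (fun x : subvs_of s => rho x phi)))%VS.

Lemma memv_ann phi x :
  reflect (x \in s /\ rho (vsproj s x) phi = 0) (x \in ann phi).
Proof.
have lin : linear (fun x : subvs_of s => rho x phi).
  by move=> a y z; rewrite linearP add_lfunE scale_lfunE.
apply: (iffP memv_imgP) => [[y + ->]|[sx e]].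
  by rewrite memv_ker linear_lfunE // lfunE /= subvsP vsvalK => /eqP.
exists (vsproj s x); last by rewrite lfunE /= vsprojK.
by rewrite memv_ker linear_lfunE // e.
Qed.

End Modules.

(* Main.v *)
(* Let G be the set of the i with <mu, alpha_i> = 0.  A positive root space
   g_beta meets a nontrivially, and then lies in a, exactly when every simple
   root occurring in beta has its index in G; all three claims can be read off
   this.
   If x in a has weight beta, then a, being stable under the negative root
   spaces, contains for each alpha_i occurring in beta a nonzero vector of
   g_{alpha_i}: otherwise the orthogonal of a for the Killing form would contain
   g_{-alpha_i}, hence the lower module it generates, hence g_{-beta}.
   Bracketing with g_{-alpha_i} yields the element of h dual to alpha_i in
   a_0 = ann(phi0), that is <mu, alpha_i> = 0.  Conversely sl2-theory gives
   g_{alpha_i} in a for i in G, and g_beta is generated by simple root spaces.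
   The Killing form is nondegenerate because h is toral: on t = [x, y], with x
   and y in opposite root spaces, every weight is a rational multiple of a
   single one, so t = 0 as soon as t is in the radical K.  Hence [K, K] avoids h,
   and by Engel's argument an ideal that avoids h is nilpotent, hence zero. *)

(* Why orthogonal complements: pushing a given vector of [a] down by simple root vectors may give
   zero long before g_{alpha_i} is reached, and nothing says which path survives. The orthogonal
   complement of a space stable under the negative root spaces is stable again, and it only has to
   be generated from g_{-alpha_i}, a question about root spaces and no longer about one vector. The
   same duality shows that g_beta is spanned by the brackets [g_{alpha_i}, g_{beta - alpha_i}]. It
   works because every space involved is stable under h, hence spanned by its weight vectors, so
   that inclusions, brackets and orthogonality need only be tested on these. *)
Require Import Defs.
From HB Require Import structures.
From mathcomp Require Import all_boot all_order all_algebra.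
From mathcomp Require Import complex ring.
From mathcomp Require Import classical_sets reals boolp.
Set Implicit Arguments.
Unset Strict Implicit.
Unset Printing Implicit Defensive.
Import Order.TTheory GRing.Theory Num.Theory.
Local Open Scope ring_scope.

(** * Diagonalizable endomorphisms and traces *)

Section Eigenvectors.
Variables (F : fieldType) (V : vectType F).
Implicit Types (f : 'End(V)) (U W : {vspace V}).

Lemma leigenspaceP f a x :
  reflect (f x = a *: x) (x \in passmx.leigenspace f a).
Proof.
rewrite memv_ker add_lfunE opp_lfunE scale_lfunE id_lfunE subr_eq0.
exact: eqP.
Qed.

Lemma sum_leigenspace_stable f (s : seq F) x :
  x \in (\sum_(a <- s) passmx.leigenspace f a)%VS ->
  f x \in (\sum_(a <- s) passmx.leigenspace f a)%VS.
Proof.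
elim: s x => [|a s IHs] x; first by rewrite big_nil !memv0 => /eqP ->; rewrite linear0.
rewrite big_cons => /memv_addP[u /leigenspaceP fu [v /IHs fv ->]].
rewrite linearD /= fu memv_add // memvZ //.
by apply/leigenspaceP.
Qed.

Lemma sum_leigenspace_eq0 f (s : seq F) c x :
  x \in (\sum_(a <- s) passmx.leigenspace f a)%VS -> f x = c *: x -> c \notin s -> x = 0.
Proof.
elim: s x => [|a s IHs] x; first by rewrite big_nil memv0 => /eqP.
rewrite big_cons inE negb_or => /memv_addP[u /leigenspaceP fu [v sv ->]] fx.
case/andP=> ca cs.
have e : (c - a) *: (u + v) = f v - a *: v.
  by rewrite scalerBl -fx linearD /= fu scalerDr opprD addrACA subrr add0r.
have : (c - a) *: (u + v) = 0.
  apply: (IHs _ _ _ cs); first by rewrite e memvB ?memvZ ?sum_leigenspace_stable.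
  by rewrite linearZ /= fx !scalerA mulrC.
by move/eqP; rewrite scaler_eq0 subr_eq0 (negPf ca) => /eqP.
Qed.

(** If no [v n] vanished, the first n eigenspaces would have a sum of dimension at least n, for
    every n. All nilpotency below comes from here: a root vector shifts an eigenvalue by a fixed
    nonzero amount at each application. *)
Lemma eigenvector_seq_eq0 f (v : nat -> V) (c : nat -> F) :
  injective c -> (forall n, f (v n) = c n *: v n) -> exists n, v n = 0.
Proof.
move=> cI fv; apply: contrapT => v0.
pose W n := (\sum_(a <- [seq c i | i <- iota 0 n]) passmx.leigenspace f a)%VS.
have : forall n, (n <= \dim (W n))%N.
  elim=> // n IHn; rewrite /W -addn1 iotaD map_cat big_cat /= big_seq1 add0n.
  rewrite dimv_disjoint_sum.
    rewrite leq_add // lt0n dimv_eq0; apply/eqP => E0; apply: v0; exists n.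
    by apply/eqP; rewrite -memv0 -E0; apply/leigenspaceP.
  apply/eqP; rewrite -subv0; apply/subvP => x; rewrite memv_cap memv0.
  case/andP=> xW /leigenspaceP fx; apply/eqP; apply: sum_leigenspace_eq0 xW fx _.
  by apply/mapP; case=> i; rewrite mem_iota => /andP[_ lin] /cI E; rewrite E add0n ltnn in lin.
move/(_ (\dim {:V}).+1); apply/negP; rewrite -leqNgt.
exact/dimvS/subvf.
Qed.

End Eigenvectors.

Section Diagonalizable.
Variables (F : fieldType) (g : lieAlgType F) (f : 'End(g)).
Hypothesis diag_f : is_diagonalizable f.
Implicit Types (U W : {vspace g}).

Lemma diagonalizable_sum :
  exists s : seq F, (fullv <= \sum_(a <- s) passmx.leigenspace f a)%VS.
Proof.
have [e [be /fin_all_exists[c fe]]] := diag_f.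
exists [seq c i | i : 'I__]; rewrite -[X in (X <= _)%VS](span_basis be).
apply/span_subvP => _ /tnthP[i ->]; rewrite big_image /=.
rewrite memvE (sumv_sup i) // -memvE.
exact/leigenspaceP.
Qed.

(** Induction on the number of eigenspaces involved in [x]: for a != b, both f x - a x and f x - b x
    involve one eigenspace fewer, and they differ by (a - b) x. *)
Lemma diagonalizable_ind U W :
  (forall x, x \in U -> f x \in U) ->
  (forall x a, x \in U -> f x = a *: x -> x \in W) -> (U <= W)%VS.
Proof.
move=> fU UW; have [s fs] := diagonalizable_sum.
suff sW n : forall s x, (size s <= n)%N -> x \in U ->
    x \in (\sum_(a <- s) passmx.leigenspace f a)%VS -> x \in W.
  by apply/subvP => x Ux; apply: (sW _ s) => //; rewrite (subvP fs) ?memvf.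
elim: n => [|n IHn] {fs}s x.
  by rewrite leqn0 size_eq0 => /eqP -> _; rewrite big_nil memv0 => /eqP ->; rewrite mem0v.
case: s => [|a [|b s]] //= sn Ux.
- by rewrite big_nil memv0 => /eqP ->; rewrite mem0v.
- by rewrite big_seq1 => /leigenspaceP; apply: UW.
rewrite big_cons => /memv_addP[u /leigenspaceP fu [v sv xE]].
have fxU c : f x - c *: x \in U by rewrite memvB ?fU ?memvZ.
have fa : f x - a *: x \in W.
  apply: (IHn (b :: s)) => //; rewrite xE linearD /= fu scalerDr opprD addrACA subrr.
  by rewrite add0r memvB ?memvZ ?sum_leigenspace_stable.
have [eab|nab] := eqVneq a b.
  apply: (IHn (b :: s)) => //; rewrite xE memvD // big_cons -eab memvE.
  by rewrite (subv_trans _ (addvSl _ _)) // -memvE; apply/leigenspaceP.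
have fb : f x - b *: x \in W.
  apply: (IHn (a :: s)) => //; rewrite big_cons xE.
  move: sv; rewrite big_cons => /memv_addP[v1 /leigenspaceP fv1 [v2 sv2 ->]].
  have -> : f (u + (v1 + v2)) - b *: (u + (v1 + v2))
     = (a - b) *: u + (f v2 - b *: v2).
    have -> : f (u + (v1 + v2)) = f u + (f v1 + f v2) by rewrite !linearD.
    rewrite fu fv1 !scalerDr scalerBl !opprD.
    rewrite addrACA; congr (_ + _); rewrite addrACA subrr add0r //.
  rewrite memv_add ?memvB ?memvZ ?sum_leigenspace_stable //.
  exact/leigenspaceP.
have -> : x = (a - b)^-1 *: ((f x - b *: x) - (f x - a *: x)).
  rewrite opprB [f x - _ + _]addrC addrA subrK -scalerBl scalerA mulVf ?scale1r //.
  by rewrite subr_eq0.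
by rewrite memvZ // memvB.
Qed.

End Diagonalizable.

Section Trace.
Variables (F : fieldType) (g : lieAlgType F).
Implicit Types f : 'End(g).

(** [lftrace] is defined in the basis [vbasis], but the Killing form on h becomes a sum of squares
    only in an eigenbasis. *)
Lemma lftrace_basis (e : (\dim {:g}).-tuple g) f : basis_of fullv e ->
  lftrace f = \sum_i coord e i (f e`_i).
Proof.
move=> be; rewrite /lftrace.
have bv := vbasisP (fullv : {vspace g}).
set v := vbasis _.
have cE (b1 b2 : (\dim {:g}).-tuple g) (y : g) i : basis_of fullv b2 ->
    coord b1 i y = \sum_j coord b2 j y * coord b1 i b2`_j.
  move=> bb; rewrite {1}(coord_basis bb (memvf y)) linear_sum.
  by apply: eq_bigr => j _; rewrite linearZ.
under eq_bigr => i _ do rewrite (cE v e _ i be).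
rewrite exchange_big; apply: eq_bigr => j _ /=.
have {2}-> : e`_j = \sum_i coord v i e`_j *: v`_i by apply: coord_basis (memvf _).
rewrite linear_sum linear_sum; apply: eq_bigr => i _.
by rewrite !linearZ /= mulrC.
Qed.

Lemma lftraceC (f1 f2 : 'End(g)) : lftrace (f1 \o f2)%VF = lftrace (f2 \o f1)%VF.
Proof.
have bv := vbasisP (fullv : {vspace g}).
have E f f' : lftrace (f \o f')%VF =
    \sum_(i < \dim {:g}) \sum_(j < \dim {:g}) coord (vbasis fullv) j (f' (vbasis fullv)`_i) *
                  coord (vbasis fullv) i (f (vbasis fullv)`_j).
  rewrite /lftrace; apply: eq_bigr => i _; rewrite comp_lfunE.
  rewrite {1}(coord_basis bv (memvf (f' _))) !linear_sum.
  by apply: eq_bigr => j _; rewrite !linearZ.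
rewrite !E exchange_big; apply: eq_bigr => i _; apply: eq_bigr => j _.
by rewrite mulrC.
Qed.

End Trace.

(** Twice E Y^(n+1) v equals (n+1)(2c - a n) Y^n v, so 2c = a n at the first n with Y^(n+1) v = 0.
    Leaving [a] free instead of normalising it to 2 admits arbitrary opposite root vectors, even
    with a = 0. *)
Lemma sl2_string (F : numFieldType) (V : vectType F) (E Y T : 'End(V)) (a c : F) (v : V) :
    (forall w, E (Y w) = Y (E w) + T w) ->
    (forall w, T (Y w) = Y (T w) - a *: Y w) ->
    v != 0 -> E v = 0 -> T v = c *: v -> (exists n, iter n Y v = 0) ->
  exists N, [/\ iter N Y v != 0, iter N.+1 Y v = 0 & 2 * c = a * N%:R].
Proof.
move=> EY TY v0 Ev Tv Yv.
have YZ b w : Y (b *: w) = b *: Y w by exact: linearZ.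
have TYn n : T (iter n Y v) = (c - n%:R * a) *: iter n Y v.
  elim: n => [|n IHn]; first by rewrite mul0r subr0.
  rewrite iterS TY IHn linearZ /= -scalerBl; congr (_ *: _); rewrite mulrS; ring.
have EYn n : 2 *: E (iter n.+1 Y v) = (n.+1%:R * (2 * c - a * n%:R)) *: iter n Y v.
  elim: n => [|n IHn]; first by rewrite /= EY Ev linear0 add0r Tv scalerA; congr (_ *: _); ring.
  rewrite iterS EY scalerDr -YZ IHn YZ TYn -[Y (iter n Y v)]/(iter n.+1 Y v).
  rewrite scalerA -scalerDl; congr (_ *: _); rewrite !mulrS; ring.
have exY : exists n, iter n Y v == 0 by case: Yv => n /eqP; exists n.
have [[|N] /eqP YN minN] := ex_minnP exY; first by rewrite [v]YN eqxx in v0.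
exists N; split=> //.
  by apply/negP => /minN; rewrite ltnn.
have := EYn N; rewrite YN linear0 scaler0 => /esym/eqP; rewrite scaler_eq0 mulf_eq0.
rewrite pnatr_eq0 subr_eq0 /= => /orP[/eqP //|/minN]; by rewrite ltnn.
Qed.

(** * Weight spaces of a Cartan subalgebra *)

Section LieBasics.
Variables (F : fieldType) (g : lieAlgType F).
Implicit Types (x y z : g) (U W : {vspace g}).

Lemma lie0 x : lie 0 x = 0.
Proof. by rewrite lieC linear0 oppr0. Qed.

Lemma lieNr x y : lie x (- y) = - lie x y. Proof. exact: linearN. Qed.
Lemma lieNl x y : lie (- x) y = - lie x y.
Proof. by rewrite lieC lieNr opprK lieC. Qed.
Lemma lieZl a x y : lie (a *: x) y = a *: lie x y.
Proof. by rewrite lieC linearZ /= -scalerN -lieC. Qed.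

Lemma lie_lie x y z : lie x (lie y z) = lie (lie x y) z + lie y (lie x z).
Proof.
have /eqP := jacobi x y z; rewrite -addrA addr_eq0 => /eqP ->.
by rewrite opprD addrC [lie (lie x y) z]lieC [lie x z]lieC lieNr.
Qed.

Lemma abelian_ideal_eq0 U :
  is_semisimple g -> is_ideal U -> is_abelian U -> U = 0%VS.
Proof.
move=> ss iU aU; apply: ss => //; exists 1%N => /=.
apply/eqP; rewrite -subv0; apply/liev_subP => x y Ux Uy.
by rewrite aU // mem0v.
Qed.

Lemma killing_lie x y z : killing (lie x y) z = killing x (lie y z).
Proof.
have adlie (u v : g) : ad (lie u v) = (ad u \o ad v)%VF - (ad v \o ad u)%VF.
  apply/lfunP => w; rewrite add_lfunE opp_lfunE !comp_lfunE !adE.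
  by rewrite (lie_lie u v w) addrK.
rewrite /killing !adlie comp_lfunDl comp_lfunDr comp_lfunNl comp_lfunNr.
have lftraceN (f : 'End(g)) : lftrace (- f) = - lftrace f.
  by rewrite -scaleN1r lftraceZ mulN1r.
rewrite !lftraceD !lftraceN comp_lfunA; congr (_ - _).
by rewrite -comp_lfunA lftraceC comp_lfunA.
Qed.

Lemma killingC x y : killing x y = killing y x.
Proof. exact: lftraceC. Qed.

Lemma killing0 x : killing x 0 = 0. Proof. exact: linear0. Qed.

Lemma killingZ a x y : killing x (a *: y) = a * killing x y.
Proof. exact: linearZ. Qed.

Lemma killingZl a x y : killing (a *: x) y = a * killing x y.
Proof. by rewrite killingC killingZ killingC. Qed.

End LieBasics.

Section Cartan.
Variables (F : numFieldType) (g : lieAlgType F) (h : {vspace g}).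
Definition hstable (U : {vspace g}) := forall H x, H \in h -> x \in U -> lie H x \in U.

Variables (l : nat) (alpha : 'I_l -> dual h) (Z : 'I_l -> subvs_of h).
Hypotheses (cartan_h : is_cartan h) (dualZ : is_dual_basis alpha Z).
Implicit Types (x y : g) (U W : {vspace g}) (beta gamma : dual h).

Let h_abelian : is_abelian h. Proof. by case: cartan_h. Qed.
Let h_self x : (forall y, y \in h -> lie x y = 0) -> x \in h.
Proof. by case: cartan_h => _ + _; apply. Qed.
Let h_diag x : x \in h -> is_diagonalizable (ad x).
Proof. by case: cartan_h => _ _; apply. Qed.

Lemma cartan_span (H : subvs_of h) : H = \sum_i coord [tuple Z i | i < l] i H *: Z i.
Proof.
rewrite {1}(coord_basis dualZ.1 (memvf H)); apply: eq_bigr => i _.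
by rewrite -tnth_nth tnth_mktuple.
Qed.

Lemma dual_eq beta gamma : (forall i, beta (Z i) = gamma (Z i)) -> beta = gamma.
Proof.
move=> E; apply/lfunP => H; rewrite (cartan_span H) !linear_sum.
by apply: eq_bigr => i _; rewrite !linearZ /= E.
Qed.

Lemma dual_sum_coord (c : 'I_l -> F) i : (\sum_j c j *: alpha j) (Z i) = c i.
Proof.
rewrite sum_lfunE (bigD1 i) //= scale_lfunE dualZ.2 eqxx big1 ?addr0 => [|j ji].
  by rewrite /GRing.scale /= mulr1.
by rewrite scale_lfunE dualZ.2 (negPf ji) /GRing.scale /= mulr0.
Qed.

Lemma dual_decomp beta : beta = \sum_i (beta (Z i) : F) *: alpha i.
Proof. by apply: dual_eq => i; rewrite dual_sum_coord. Qed.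

Lemma root_spaceP beta x :
  reflect (forall i, lie (vsval (Z i)) x = (beta (Z i) : F) *: x) (x \in root_space beta).
Proof.
apply: (iffP (memv_root_space _ _)) => [E i|E H]; first exact: E.
rewrite {2}(cartan_span H) [in LHS](cartan_span H) !linear_sum.
rewrite lieC linear_sum -sumrN scaler_suml; apply: eq_bigr => i _.
by rewrite !linearZ /= -lieC E scalerA.
Qed.

Lemma root_space_lie beta gamma x y :
  x \in root_space beta -> y \in root_space gamma -> lie x y \in root_space (beta + gamma).
Proof.
move=> /memv_root_space hx /memv_root_space hy; apply/memv_root_space => H.
rewrite lie_lie hx hy lieZl linearZ /= -scalerDl; congr (_ *: _).
by rewrite add_lfunE.
Qed.

Lemma root_space0 : root_space (0 : dual h) = h.
Proof.
apply/eqP; rewrite eqEsubv; apply/andP; split; apply/subvP => x.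
  move/memv_root_space => hx; apply: h_self => y hy.
  by rewrite lieC -(vsprojK hy) hx zero_lfunE scale0r oppr0.
move=> hx; apply/memv_root_space => H.
by rewrite zero_lfunE scale0r h_abelian ?subvsP.
Qed.

Lemma hstable_root_space beta : hstable (root_space beta).
Proof.
move=> H x hH; rewrite -{1}root_space0 in hH * => xb.
by rewrite -[beta]add0r root_space_lie.
Qed.

Lemma hstable_cap U W : hstable U -> hstable W -> hstable (U :&: W)%VS.
Proof.
by move=> hU hW H x hH; rewrite !memv_cap => /andP[Ux Wx]; rewrite hU ?hW.
Qed.

Lemma hstable_add U W : hstable U -> hstable W -> hstable (U + W)%VS.
Proof.
move=> hU hW H x hH /memv_addP[u Uu [w Ww ->]].
by rewrite linearD memv_add ?hU ?hW.
Qed.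

Lemma hstable_sum I (r : seq I) (P : pred I) (U : I -> {vspace g}) :
  (forall i, P i -> hstable (U i)) -> hstable (\sum_(i <- r | P i) U i)%VS.
Proof.
move=> hU; elim/big_rec: _ => [H x _|i W Pi hW]; last exact/hstable_add/hW/hU.
by rewrite !memv0 => /eqP ->; rewrite linear0.
Qed.

(* Simultaneous diagonalization of the ad H, H in h, in the form of an
   induction principle. *)
Lemma weight_ind U W : hstable U ->
  (forall beta x, x \in U -> x \in root_space beta -> x \in W) -> (U <= W)%VS.
Proof.
move=> hU UW.
(* Diagonalizing one [Z i] replaces the subspace by its intersection with an eigenspace, so the
   induction must quantify over all h-stable subspaces. *)
suff sW (s : seq 'I_l) : forall U', hstable U' ->
    (forall c x, x \in U' -> (forall i, i \in s -> lie (vsval (Z i)) x = c i *: x) ->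
       x \in W) -> (U' <= W)%VS.
  apply: (sW (enum 'I_l)) => // c x Ux cx; apply: (UW (\sum_i c i *: alpha i)) => //.
  by apply/root_spaceP => i; rewrite dual_sum_coord cx ?mem_enum.
elim: s => [|i s IHs] U' hU' U'W.
  by apply/subvP => x Ux; apply: (U'W (fun=> 0) x Ux).
apply: (diagonalizable_ind (h_diag (subvsP (Z i)))) => [x Ux|x a Ux ax].
  by rewrite adE hU' ?subvsP.
have hE : hstable (passmx.leigenspace (ad (vsval (Z i))) a).
  move=> H y hH /memv_leigenspace; rewrite adE => ay; apply/memv_leigenspace.
  by rewrite adE lie_lie ay (h_abelian (subvsP _) hH) lie0 add0r linearZ.
have xU : x \in (U' :&: passmx.leigenspace (ad (vsval (Z i))) a)%VS.
  by rewrite memv_cap Ux; apply/memv_leigenspace.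
apply: subvP xU; apply: IHs => [|c y]; first exact: hstable_cap.
rewrite memv_cap => /andP[Uy /memv_leigenspace]; rewrite adE => ay cy.
apply: (U'W (fun j => if j == i then a else c j)) => // j; rewrite inE.
by case: eqVneq => [->|ij] //= js; apply: cy.
Qed.

Lemma weight_vector_ex U W : hstable U -> ~~ (U <= W)%VS ->
  exists beta x, [/\ x \in U, x \in root_space beta & x \notin W].
Proof.
move=> hU; apply: contraNP => nex; apply: weight_ind => // beta x Ux bx.
by apply: contrapT => /negP Wx; apply: nex; exists beta, x.
Qed.

(** A weight is determined by its values on the [Z i], each of which is an eigenvalue. The lists
    [e i] may differ in length; an index beyond the end reads the default 0, which only adds
    candidates. *)
Lemma weights_finite :
  exists s : seq (dual h), forall beta, root_space beta != 0%VS -> beta \in s.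
Proof.
have /fin_all_exists[e eP] i := diagonalizable_sum (h_diag (subvsP (Z i))).
exists [seq \sum_i (nth 0 (e i) (f i) : F) *: alpha i
  | f : {ffun 'I_l -> 'I_(\max_i size (e i)).+1}].
move=> beta; rewrite -subv0 => /subvPn[x /memv_root_space bx]; rewrite memv0 => x0.
have be i : (beta (Z i) : F) \in e i.
  apply: contraNT x0 => be; apply/eqP.
  apply: (sum_leigenspace_eq0 (subvP (eP i) _ (memvf x)) _ be).
  by rewrite adE bx.
have lt_index i : (index (beta (Z i) : F) (e i) < (\max_i size (e i)).+1)%N.
  by rewrite ltnS (leq_trans (index_size _ _)) // leq_bigmax.
apply/codomP; exists [ffun i => Ordinal (lt_index i)].
rewrite {1}[beta]dual_decomp; apply: eq_bigr => i _.
by rewrite ffunE /= nth_index.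
Qed.

(** The iterates have weights gamma + n beta, and some [Z i] separates these in characteristic
    zero. *)
Lemma root_space_nilpotent beta gamma x v : beta != 0 ->
  x \in root_space beta -> v \in root_space gamma -> exists n, iter n (ad x) v = 0.
Proof.
move=> b0 bx gv.
have [i bi] : exists i, (beta (Z i) : F) != 0.
  apply: contrapT => nb; case/eqP: b0; apply: dual_eq => i; rewrite zero_lfunE.
  by apply/eqP; apply: contrapT => /negP bi; apply: nb; exists i.
have E n : iter n (ad x) v \in root_space (gamma + beta *+ n).
  elim: n => [|n IHn]; first by rewrite addr0.
  by rewrite iterS adE mulrS addrCA root_space_lie.
apply: (@eigenvector_seq_eq0 _ _ (ad (vsval (Z i))) _
          (fun n => (gamma (Z i) : F) + (beta (Z i) : F) *+ n)) => [m n /addrI/eqP|n].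
  by rewrite -[_ *+ m]mulr_natr -[_ *+ n]mulr_natr (inj_eq (mulfI bi)) eqr_nat => /eqP.
rewrite adE; have /memv_root_space -> := E n.
rewrite add_lfunE; congr ((_ + _) *: _).
by rewrite -scaler_nat scale_lfunE -[RHS]mulr_natl.
Qed.

(* Move v up the beta-string to its top, where sl2_string applies to the way down. *)
Lemma weight_string beta gamma x y v : beta != 0 ->
    x \in root_space beta -> y \in root_space (- beta) ->
    v \in root_space gamma -> v != 0 ->
  exists q : F, q \is Num.real /\
    lie (lie x y) v = (q * beta (vsproj h (lie x y))) *: v.
Proof.
move=> b0 xb yb vg v0; set t := lie x y.
have ht : t \in h by rewrite -root_space0 -(subrr beta) root_space_lie.
have exX : exists n, iter n (ad x) v == 0.
  by case: (root_space_nilpotent b0 xb vg) => n /eqP; exists n.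
have [[|m] /eqP xm minm] := ex_minnP exX; first by rewrite [v]xm eqxx in v0.
set w := iter m (ad x) v in xm.
have w0 : w != 0 by apply/negP => /minm; rewrite ltnn.
have wE : w \in root_space (gamma + beta *+ m).
  rewrite /w; elim: (m) => [|n IHn]; first by rewrite addr0.
  by rewrite iterS adE mulrS addrCA root_space_lie.
have tE delta u : u \in root_space delta -> lie t u = (delta (vsproj h t) : F) *: u.
  by move/memv_root_space => /(_ (vsproj h t)); rewrite vsprojK.
have b0N : - beta != 0 by rewrite oppr_eq0.
have [N [_ _ Nw]] : exists N, [/\ iter N (ad y) w != 0, iter N.+1 (ad y) w = 0
    & 2 * ((gamma + beta *+ m) (vsproj h t) : F) = (beta (vsproj h t) : F) * N%:R].
  apply: (@sl2_string _ _ (ad x) (ad y) (ad t)) => //.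
  - by move=> u; rewrite !adE lie_lie addrC.
  - move=> u; rewrite !adE lie_lie addrC; congr (_ + _).
    by rewrite (tE _ _ yb) opp_lfunE scaleNr lieNl lieZl.
  - by rewrite adE (tE _ _ wE).
  - exact: root_space_nilpotent b0N yb wE.
(* The top of the string is m steps above v and has N steps below it: 2 (gamma + m beta)(t) = N
   beta(t), to be solved for gamma(t). *)
exists (2^-1 * (N%:R - 2 * m%:R)); split.
  by rewrite realM ?realB ?realM ?realV ?realn.
rewrite (tE _ _ vg); congr (_ *: _).
have : (gamma + beta *+ m) (vsproj h t) =
    (gamma (vsproj h t) : F) + m%:R * beta (vsproj h t) :> F.
  by rewrite add_lfunE -scaler_nat scale_lfunE.
move=> E; rewrite E in Nw.
have n2 : 2 != 0 :> F by rewrite pnatr_eq0.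
apply: (mulfI n2).
have -> : 2 * (2^-1 * (N%:R - 2 * m%:R) * beta (vsproj h t)) =
   (beta (vsproj h t) : F) * N%:R - 2 * (m%:R * beta (vsproj h t)) :> F.
  by field.
by rewrite -Nw; ring.
Qed.
End Cartan.

(** * Nondegeneracy of the Killing form *)

Section KillingPerp.
Variables (F : fieldType) (g : lieAlgType F).
Implicit Types (x y z : g) (U W : {vspace g}).

Definition kappa : 'Hom(g, 'Hom(g, F^o)) :=
  linfun (fun x => linfun (killing x : g -> F^o)).

Lemma kappaE x y : kappa x y = killing x y.
Proof.
rewrite /kappa linear_lfunE ?lfunE // => a u v.
apply/lfunP => z; rewrite add_lfunE scale_lfunE !lfunE /=.
exact: killing_linearl.
Qed.

(** Composing with the projection onto [W] makes the orthogonal complement the kernel of a single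
    linear map. *)
Definition kperp W : {vspace g} :=
  lker (linfun (fun x : g => (kappa x \o projv W)%VF)).

Lemma kperpP W x : reflect (forall y, y \in W -> killing x y = 0) (x \in kperp W).
Proof.
rewrite memv_ker linear_lfunE => [|a u v]; last first.
  by rewrite linearP comp_lfunDl comp_lfunZl.
apply: (iffP eqP) => [E y Wy|E].
  have /lfunP/(_ y) := E; rewrite comp_lfunE projv_id // kappaE => ->.
  by rewrite zero_lfunE.
by apply/lfunP => y; rewrite comp_lfunE kappaE E ?memv_proj // zero_lfunE.
Qed.

(** For x outside W some linear form vanishes on W but not at x. Nondegeneracy represents it by some
    y, which lies in [kperp W] without being orthogonal to x. *)
Lemma kperp_perp W x : lker kappa = 0%VS ->
  (forall y, y \in kperp W -> killing y x = 0) -> x \in W.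
Proof.
move=> K0 xW; have kS : limg kappa = fullv.
  apply/eqP; rewrite eqEdim subvf limg_dim_eq ?K0 ?capv0 //.
  by rewrite !dimvf -[leqRHS]muln1; apply: leqnn.
apply: contrapT => nxW.
have px : x - projv W x != 0.
  by apply: contra_notN nxW; rewrite subr_eq0 => /eqP ->; apply: memv_proj.
have [i ci] : exists i, coord (vbasis fullv) i (x - projv W x) != 0.
  apply: contrapT => nc; case/eqP: px; rewrite (coord_vbasis (memvf (x - projv W x))).
  rewrite big1 // => i _; suff -> : coord (vbasis fullv) i (x - projv W x) = 0.
    by rewrite scale0r.
  by apply/eqP; apply: contrapT => /negP ci; apply: nc; exists i.
pose phi : 'Hom(g, F^o) :=
  linfun (fun y => coord (vbasis fullv) i (y - projv W y) : F^o).
have phiE y : phi y = coord (vbasis fullv) i (y - projv W y).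
  rewrite /phi linear_lfunE // => a u v.
  by rewrite linearP opprD addrACA -scalerN -scalerDr linearP.
have /memv_imgP[y _ yE] : phi \in limg kappa by rewrite kS memvf.
case/eqP: ci; rewrite -phiE yE kappaE xW //.
by apply/kperpP => z Wz; rewrite -kappaE -yE phiE projv_id // subrr linear0.
Qed.

End KillingPerp.

(** * Engel's theorem for h-stable subalgebras *)

Section Engel.
Variables (F : numFieldType) (g : lieAlgType F) (h : {vspace g}).
Variables (l : nat) (alpha : 'I_l -> dual h) (Z : 'I_l -> subvs_of h).
Hypotheses (cartan_h : is_cartan h) (dualZ : is_dual_basis alpha Z).
Implicit Types (x y : g) (U W M Q : {vspace g}) (beta gamma : dual h).

Lemma hstable_transporter U W :
  hstable h U -> hstable h W -> hstable h (transporter U W).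
Proof.
move=> hU hW H x hH /memv_transporter xW; apply/memv_transporter => y Uy.
have -> : lie (lie H x) y = lie H (lie x y) - lie x (lie H y).
  by rewrite (lie_lie H x y) addrK.
by rewrite memvB ?(hW H) ?xW ?(hU H).
Qed.

(** Engel's conclusion for [Q] acting on (W + M) / M, written without quotients. The quantification
    over M and W allows its use for Q' acting on Q modulo Q' as well as for a given pair. *)
Definition engel Q := forall M W, hstable h M -> hstable h W -> ~~ (W <= M)%VS ->
  (forall q x, q \in Q -> x \in M -> lie q x \in M) ->
  (forall q x, q \in Q -> x \in W -> lie q x \in W) ->
  exists v, [/\ v \in W, v \notin M & forall q, q \in Q -> lie v q \in M].

(** The normaliser of Q' in Q is h-stable and not contained in Q', so the new element x can be
    chosen to be a weight vector. Its weight is nonzero because Q avoids h, which makes ad x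
    nilpotent on weight vectors. *)
Lemma engel_extend Q Q' :
  is_subalgebra Q -> hstable h Q -> (Q :&: h = 0)%VS ->
  is_subalgebra Q' -> hstable h Q' -> (Q' <= Q)%VS -> ~~ (Q <= Q')%VS -> engel Q' ->
  exists x, [/\ x \in Q, x \notin Q', is_subalgebra (Q' + <[x]>),
    hstable h (Q' + <[x]>) & engel (Q' + <[x]>)].
Proof.
move=> subQ hQ Qh subQ' hQ' sQ'Q nsQQ' eQ'.
have [v [Qv nQ'v vQ']] : exists v, [/\ v \in Q, v \notin Q' & forall q, q \in Q' -> lie v q \in Q'].
  apply: eQ' => // q x Q'q Qx.
  by apply: subQ => //; apply: (subvP sQ'Q).
pose N := (Q :&: transporter Q' Q')%VS.
have hN : hstable h N by apply: hstable_cap => //; apply: hstable_transporter.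
have [|beta [x [+ bx nQ'x]]] := weight_vector_ex cartan_h dualZ (W := Q') hN.
  by apply/subvPn; exists v => //; rewrite memv_cap Qv; apply/memv_transporter.
rewrite memv_cap => /andP[Qx /memv_transporter xQ'].
have b0 : beta != 0.
  apply: contraNneq nQ'x => b0; suff -> : x = 0 by apply: mem0v.
  by apply/eqP; rewrite -memv0 -Qh memv_cap Qx -(root_space0 cartan_h) -b0.
have hx H : H \in h -> lie H x = (beta (vsproj h H) : F) *: x.
  by move=> hH; have /memv_root_space/(_ (vsproj h H)) := bx; rewrite vsprojK.
exists x; split=> //.
- move=> y1 y2 /memv_addP[q1 Q1 [_ /vlineP[c1 ->] ->]].
  move=> /memv_addP[q2 Q2 [_ /vlineP[c2 ->] ->]].
  apply: (subvP (addvSl _ _)).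
  rewrite lieDl linearD /= [lie (c1 *: x) _]linearD /= !lieZl !linearZ /= liexx !scaler0 addr0.
  have q1x : lie q1 x \in Q' by rewrite lieC memvN xQ'.
  by rewrite !memvD ?memvZ ?q1x ?xQ' ?subQ'.
- apply: hstable_add => // H _ hH /vlineP[c ->].
  by rewrite linearZ /= hx // !memvZ ?memv_line.
move=> M W hM hW nWM QM QW.
(* These are the vectors of W that Q' sends into M; x preserves them because it normalises Q'. *)
pose W' := (W :&: transporter Q' M)%VS.
have hW' : hstable h W' by apply: hstable_cap => //; apply: hstable_transporter.
have Q'S q : q \in Q' -> q \in (Q' + <[x]>)%VS by apply/subvP/addvSl.
have xS : x \in (Q' + <[x]>)%VS by rewrite (subvP (addvSr _ _)) ?memv_line.
have [v1 [Wv1 nMv1 v1M]] : exists v, [/\ v \in W, v \notin M & forall q, q \in Q' -> lie v q \in M].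
  by apply: eQ' => // q y /Q'S Qq; [apply: QM|apply: QW].
have [|gamma [w [W'w gw nMw]]] := weight_vector_ex cartan_h dualZ (W := M) hW'.
  by apply/subvPn; exists v1 => //; rewrite memv_cap Wv1; apply/memv_transporter.
have xW' u : u \in W' -> lie x u \in W'.
  rewrite !memv_cap => /andP[Wu /memv_transporter uM]; rewrite QW //=.
  apply/memv_transporter => q Q'q.
  have -> : lie (lie x u) q = lie x (lie u q) - lie u (lie x q).
    by rewrite (lie_lie x u q) addrK.
  by rewrite memvB ?(QM x) ?uM ?xQ'.
have W'n n : iter n (ad x) w \in W' by elim: n => // n IHn; rewrite iterS adE xW'.
have exM : exists n, iter n (ad x) w \in M.
  have [n xn] := root_space_nilpotent dualZ b0 bx gw.
  by exists n; rewrite xn mem0v.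
(* The last iterate outside M is sent into M by x, and also by Q' since it lies in [W']. *)
have [[|n] Mn minn] := ex_minnP exM; first by case/negP: nMw.
exists (iter n (ad x) w); have := W'n n; rewrite memv_cap => /andP[Wn /memv_transporter nM].
split=> //; first by apply/negP => /minn; rewrite ltnn.
move=> y /memv_addP[q Qq [_ /vlineP[c ->] ->]].
by rewrite linearD /= memvD ?(nM q Qq) // linearZ /= memvZ // lieC memvN -adE.
Qed.

Lemma engel_hstable Q : is_subalgebra Q -> hstable h Q -> (Q :&: h = 0)%VS -> engel Q.
Proof.
move=> subQ hQ Qh.
have : exists Q', [/\ is_subalgebra Q', hstable h Q', (Q' <= Q)%VS, engel Q'
                   & (\dim Q <= \dim Q')%N].
  elim: {-2}(\dim Q) (leqnn (\dim Q)) => [_|n IHn nQ].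
    exists 0%VS; split=> //; rewrite ?sub0v //.
    - by move=> x y; rewrite !memv0 => /eqP -> _; rewrite lie0.
    - by move=> H x _; rewrite !memv0 => /eqP ->; rewrite linear0.
    move=> M W _ _ /subvPn[v Wv nMv] _ _; exists v; split=> // q.
    by rewrite memv0 => /eqP ->; rewrite linear0 mem0v.
  have [Q' [subQ' hQ' sQ'Q eQ' nQ']] := IHn (ltnW nQ).
  have [lt_n|le_n] := ltnP n (\dim Q'); first by exists Q'.
  have nsQQ' : ~~ (Q <= Q')%VS.
    by apply/negP => /dimvS; rewrite leqNgt => /negP; apply; apply: leq_ltn_trans nQ.
  have [x [Qx nQ'x ? ? ?]] := engel_extend subQ hQ Qh subQ' hQ' sQ'Q nsQQ' eQ'.
  exists (Q' + <[x]>)%VS; split=> //; first by rewrite subv_add sQ'Q -memvE.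
  rewrite dimv_disjoint_sum.
    rewrite dim_vline; suff -> : x != 0 by rewrite addn1 ltnS.
    by apply: contraNneq nQ'x => ->; apply: mem0v.
  apply/eqP; rewrite -subv0; apply/subvP => y; rewrite memv_cap memv0.
  case/andP=> Q'y /vlineP[c yE]; move: Q'y; rewrite yE; case: (eqVneq c 0) => [->|c0].
    by rewrite scale0r.
  by move=> /(memvZ c^-1); rewrite scalerA mulVf // scale1r (negPf nQ'x).
case=> Q' [_ _ sQ'Q eQ' dQ'].
suff <- : Q' = Q by [].
by apply/eqP; rewrite eqEdim sQ'Q.
Qed.

End Engel.

Section WeightSpaces.
Variables (F : numFieldType) (g : lieAlgType F) (h : {vspace g}).
Variables (l : nat) (alpha : 'I_l -> dual h) (Z : 'I_l -> subvs_of h).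
Hypotheses (cartan_h : is_cartan h) (dualZ : is_dual_basis alpha Z).
Implicit Types (x y : g) (U W : {vspace g}) (beta gamma : dual h).

Lemma dual_neqP beta gamma : beta != gamma -> exists i, beta (Z i) != gamma (Z i).
Proof.
move=> bg; apply: contrapT => nb; case/eqP: bg; apply: (dual_eq dualZ) => i.
by apply/eqP; apply: contrapT => /negP bi; apply: nb; exists i.
Qed.

Lemma sum_root_space_eq0 I (r : seq I) (P : pred I) (b : I -> dual h) gamma x :
  x \in (\sum_(i <- r | P i) root_space (b i))%VS -> x \in root_space gamma ->
  (forall i, P i -> gamma != b i) -> x = 0.
Proof.
move=> + + gb; elim: r x => [|i r IHr] x; first by rewrite big_nil memv0 => /eqP.
rewrite big_cons; case: ifP => [Pi|_]; last exact: IHr.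
move=> /memv_addP[u bu [v rv xE]] gx; have [j gj] := dual_neqP (gb i Pi).
have hS : hstable h (\sum_(i <- r | P i) root_space (b i))%VS.
  by apply: hstable_sum => k _; apply: hstable_root_space.
(* Applying ad (Z j) - b i (Z j) removes the component u and multiplies x by a nonzero scalar; the
   induction hypothesis covers the shorter sum. *)
have E : (gamma (Z j) - b i (Z j) : F) *: x
    = lie (vsval (Z j)) v - (b i (Z j) : F) *: v.
  rewrite scalerBl -(memv_root_space _ _ gx) xE linearD /=.
  rewrite (memv_root_space _ _ bu) scalerDr opprD addrACA subrr add0r.
  by [].
have : (gamma (Z j) - b i (Z j) : F) *: x = 0.
  apply: IHr; last exact: memvZ.
  by rewrite E memvB ?memvZ ?hS ?subvsP.
by move/eqP; rewrite scaler_eq0 subr_eq0 (negPf gj) => /eqP.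
Qed.

Lemma killing_root_space beta gamma x y : beta + gamma != 0 ->
  x \in root_space beta -> y \in root_space gamma -> killing x y = 0.
Proof.
move=> bg bx gy; have [i bgi] := dual_neqP bg.
rewrite add_lfunE zero_lfunE in bgi.
have : ((beta (Z i) : F) + gamma (Z i)) * killing x y = 0.
  rewrite mulrDl -killingZl -killingZ -(memv_root_space _ _ bx) -(memv_root_space _ _ gy).
  by rewrite lieC -scaleN1r killingZl killing_lie mulN1r addNr.
by move/eqP; rewrite mulf_eq0 (negPf bgi) => /eqP.
Qed.

End WeightSpaces.

Section Semisimple.
Variables (F : numFieldType) (g : lieAlgType F) (h : {vspace g}).
Variables (l : nat) (alpha : 'I_l -> dual h) (Z : 'I_l -> subvs_of h).
Hypotheses (ss : is_semisimple g).
Hypotheses (cartan_h : is_cartan h) (dualZ : is_dual_basis alpha Z).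
Implicit Types (x y : g) (U W : {vspace g}) (beta gamma : dual h).

Lemma ideal_hstable U : is_ideal U -> hstable h U.
Proof. by move=> iU H x _; apply: iU. Qed.

Lemma center_eq0 x : (forall y, lie x y = 0) -> x = 0.
Proof.
move=> xc; apply/eqP; rewrite -memv0.
suff <- : <[x]>%VS = 0%VS by apply: memv_line.
apply: abelian_ideal_eq0 => //.
  by move=> y z /vlineP[c ->]; rewrite linearZ /= lieC xc oppr0 scaler0 mem0v.
by move=> y z /vlineP[c ->] _; rewrite lieZl xc scaler0.
Qed.

(** Otherwise Engel's theorem for U acting on itself gives a nonzero vector in the centre [C] of U;
    but C is an abelian ideal of g, hence zero. *)
Lemma ideal_cap_cartan_eq0 U : is_ideal U -> (U :&: h = 0)%VS -> U = 0%VS.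
Proof.
move=> iU Uh; apply/eqP; rewrite -subv0; apply: contraT => nU0.
have hU := ideal_hstable iU.
have sU : is_subalgebra U by move=> x y _; apply: iU.
have h0 : hstable h 0%VS by move=> H x _; rewrite !memv0 => /eqP ->; rewrite linear0.
have [v [Uv nv0 vU]] : exists v,
    [/\ v \in U, v \notin 0%VS & forall q, q \in U -> lie v q \in 0%VS].
  apply: (engel_hstable cartan_h dualZ sU hU Uh) => // q x.
  by rewrite !memv0 => _ /eqP ->; rewrite linear0.
pose C := (U :&: transporter U 0)%VS.
have CP x : reflect (x \in U /\ forall y, y \in U -> lie x y = 0) (x \in C).
  rewrite memv_cap; apply: (iffP andP) => -[Ux xC]; split=> //.
    by move=> y Uy; move/memv_transporter: xC => /(_ y Uy); rewrite memv0 => /eqP.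
  by apply/memv_transporter => y Uy; rewrite xC // mem0v.
have C0 : C = 0%VS.
  apply: abelian_ideal_eq0 => //.
    move=> x y /CP[Uy yC]; apply/CP; split=> [|z Uz]; first exact: iU.
    have -> : lie (lie x y) z = lie x (lie y z) - lie y (lie x z).
      by rewrite (lie_lie x y z) addrK.
    by rewrite !yC ?iU // linear0 subrr.
  by move=> x y /CP[Ux xC] /CP[Uy _]; apply: xC.
case/negP: nv0; rewrite -C0; apply/CP; split=> // q Uq.
by apply/eqP; rewrite -memv0 vU.
Qed.

(* All weights take rational multiples of [beta t] on [t = [x, y]], so the
   trace form cannot vanish on [t] unless [t] is central. *)
Lemma killing_bracket beta x y : beta != 0 ->
    x \in root_space beta -> y \in root_space (- beta) ->
  exists r : F, [/\ 0 <= r,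
    killing (lie x y) (lie x y) = (beta (vsproj h (lie x y)) : F) ^+ 2 * r
    & killing (lie x y) (lie x y) = 0 -> lie x y = 0].
Proof.
move=> b0 bx nby; set t := lie x y; set a := beta _ : F.
have ht : t \in h by rewrite -(root_space0 cartan_h) -(subrr beta) root_space_lie.
have [e [be /fin_all_exists[c ce]]] : is_diagonalizable (ad t).
  by case: cartan_h => _ _; apply.
(* The vectors of [e] need not be weight vectors. But the eigenspace of ad t for c i is h-stable, so
   it contains a weight vector, and [weight_string] applies to that one. *)
have /fin_all_exists[q qP] i : exists q : F, q \is Num.real /\ c i = q * a.
  have hE : hstable h (passmx.leigenspace (ad t) (c i)).
    move=> H z hH /memv_leigenspace; rewrite adE => tz; apply/memv_leigenspace.
    have tH : lie t H = 0 by case: cartan_h => ab _ _; apply: ab.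
    by rewrite adE lie_lie tz linearZ /= tH lie0 add0r.
  have [|gamma [v [/memv_leigenspace + gv v0]]] :=
      weight_vector_ex cartan_h dualZ (W := 0%VS) hE.
    apply/subvPn; exists (tnth e i); first exact/memv_leigenspace.
    by rewrite memv0 (free_not0 (basis_free be)) ?mem_tnth.
  rewrite memv0 in v0.
  have [r [rR rE]] := weight_string cartan_h dualZ b0 bx nby gv v0.
  rewrite adE rE => /eqP; rewrite -subr_eq0 -scalerBl scaler_eq0 (negPf v0) orbF.
  by rewrite subr_eq0 => /eqP <-; exists r.
have cE i : coord e i (ad t (ad t e`_i)) = a ^+ 2 * (q i) ^+ 2.
  rewrite -tnth_nth ce linearZ /= ce scalerA linearZ /= (tnth_nth 0).
  rewrite coord_free ?(basis_free be) // eqxx mulr1 (qP i).2; ring.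
have q2 i : true -> 0 <= q i ^+ 2.
  by move=> _; rewrite real_exprn_even_ge0 // (qP i).1.
have tr : killing t t = a ^+ 2 * \sum_i (q i) ^+ 2.
  rewrite /killing (lftrace_basis _ be) mulr_sumr; apply: eq_bigr => i _.
  by rewrite comp_lfunE cE.
exists (\sum_i (q i) ^+ 2); split=> //; first exact: sumr_ge0.
(* Either beta(t) = 0 or all [q i] vanish; in both cases every eigenvalue of ad t is zero. *)
move=> /eqP; rewrite tr mulf_eq0 sqrf_eq0 => aq.
have c0 i : c i = 0.
  rewrite (qP i).2; case/orP: aq => [/eqP ->|]; first by rewrite mulr0.
  move=> /eqP/(psumr_eq0P q2)/(_ i isT)/eqP; rewrite sqrf_eq0 => /eqP ->.
  by rewrite mul0r.
apply: center_eq0 => z; rewrite -adE (coord_basis be (memvf z)) linear_sum big1 //= => i _.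
by rewrite linearZ /= -tnth_nth ce c0 scale0r scaler0.
Qed.

Lemma lker_kappa : lker (kappa g) = 0%VS.
Proof.
set K := lker _.
have KP x : reflect (forall y, killing x y = 0) (x \in K).
  rewrite memv_ker; apply: (iffP eqP) => [E y|E].
    by rewrite -kappaE E zero_lfunE.
  by apply/lfunP => y; rewrite kappaE E zero_lfunE.
have iK : is_ideal K.
  move=> x y /KP yK; apply/KP => z.
  by rewrite lieC -scaleN1r killingZl killing_lie yK mulr0.
have hK := ideal_hstable iK.
have [s sP] := weights_finite cartan_h dualZ.
pose W := (\sum_(b <- s | b != 0%R) root_space b)%VS.
have hW : hstable h W by apply: hstable_sum => b _; apply: hstable_root_space.
have KW : (liev K K <= W)%VS.
  apply/liev_subP => x0 y0 Kx0 Ky0.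
  (* A transporter for the left argument and a preimage for the right one turn the claim on brackets
     into inclusions, so that [weight_ind] reduces both arguments to weight vectors. *)
  suff /subvP/(_ x0 Kx0)/memv_transporter/(_ y0 Ky0) : (K <= transporter K W)%VS by [].
  apply: (weight_ind cartan_h dualZ) => // beta x Kx bx.
  apply/memv_transporter => y1 Ky1; rewrite -adE memv_preim.
  suff /subvP/(_ y1 Ky1) : (K <= ad x @^-1: W)%VS by [].
  apply: (weight_ind cartan_h dualZ) => // gamma y Ky gy; rewrite -memv_preim adE.
  have [->|xy0] := eqVneq (lie x y) 0; first exact: mem0v.
  have bgxy := root_space_lie bx gy.
  have bg0 : beta + gamma != 0.
    apply: contra_neq xy0 => bg0; have gE : gamma = - beta by rewrite -(addKr beta gamma) bg0 addr0.
    have [b0|b0] := eqVneq beta 0.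
      move: bx gy; rewrite gE b0 oppr0 (root_space0 cartan_h).
      by case: cartan_h => ab _ _; apply: ab.
    rewrite gE in gy; have [r [_ _ ]] := killing_bracket b0 bx gy; apply.
    by apply/KP/iK.
  have bgs : beta + gamma \in s.
    rewrite sP //; apply: contra_neq xy0 => E.
    by apply/eqP; rewrite -memv0 -E.
  by rewrite /W (big_rem _ bgs) /= bg0 (subvP (addvSl _ _)).
have D0 : liev K K = 0%VS.
  apply: ideal_cap_cartan_eq0.
    move=> x y; have : (liev K K <= ad x @^-1: liev K K)%VS.
      have inD u v : u \in K -> v \in K -> lie u v \in liev K K.
        by move=> Ku Kv; apply/(liev_subP K K): u v Ku Kv; apply: subvv.
      apply/liev_subP => u v Ku Kv; rewrite -memv_preim adE lie_lie.
      by rewrite memvD ?inD ?iK.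
    by move=> /subvP/[apply]; rewrite -memv_preim adE.
  apply/eqP; rewrite -subv0; apply/subvP => x; rewrite memv_cap memv0.
  case/andP=> /(subvP KW) Wx; rewrite -(root_space0 cartan_h) => hx; apply/eqP.
  by apply: (sum_root_space_eq0 cartan_h dualZ Wx hx) => b; rewrite eq_sym.
apply: abelian_ideal_eq0 => // x y Kx Ky; apply/eqP; rewrite -memv0 -D0.
by apply/(liev_subP K K): x y Kx Ky; apply: subvv.
Qed.
End Semisimple.

(** * Dual elements in h and positivity of the form on roots *)

Section RootForm.
Variables (F : numFieldType) (g : lieAlgType F) (h : {vspace g}).
Variables (l : nat) (alpha : 'I_l -> dual h) (Z : 'I_l -> subvs_of h).
Hypotheses (ss : is_semisimple g).
Hypotheses (cartan_h : is_cartan h) (dualZ : is_dual_basis alpha Z).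
Implicit Types (x y : g) (U W : {vspace g}) (beta gamma : dual h).

(** Nondegeneracy gives a weight vector not orthogonal to x, and orthogonality of weight spaces
    forces its weight to be -beta. For beta = 0 this is nondegeneracy on h. *)
Lemma root_pair beta x : x \in root_space beta -> x != 0 ->
  exists2 y, y \in root_space (- beta) & killing x y = 1.
Proof.
move=> bx x0; have hf : hstable h (fullv : {vspace g}) by move=> *; apply: memvf.
have [|gamma [y [_ gy]]] := weight_vector_ex cartan_h dualZ (W := lker (kappa g x)) hf.
  apply: contra_neqN x0 => /subvP xK; apply/eqP; rewrite -memv0 -(lker_kappa ss cartan_h dualZ).
  rewrite memv_ker; apply/eqP/lfunP => z; rewrite zero_lfunE.
  by apply/eqP; rewrite -memv_ker xK ?memvf.
rewrite memv_ker kappaE => xy0.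
have bg : beta + gamma = 0.
  by apply: contra_neq_eq xy0 => bg; apply: (killing_root_space dualZ bg bx gy).
exists ((killing x y)^-1 *: y); last by rewrite killingZ mulVf.
by rewrite memvZ // -[- beta]addr0 -bg addKr.
Qed.

Lemma is_rootN beta : is_root beta -> is_root (- beta).
Proof.
case=> b0; rewrite -subv0 => /subvPn[x bx]; rewrite memv0 => x0.
have [y yb xy] := root_pair bx x0.
split; first by rewrite oppr_eq0.
rewrite -subv0; apply/subvPn; exists y => //; rewrite memv0.
by apply: contra_eq_neq xy => ->; rewrite killing0 eq_sym oner_eq0.
Qed.

Definition tvec beta : subvs_of h := (killing_map h)^-1%VF beta.

Lemma cartan_killing_eq0 x : x \in h ->
  (forall y, y \in h -> killing x y = 0) -> x = 0.
Proof.
move=> hx xh; apply: contrapT => /eqP x0.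
rewrite -(root_space0 cartan_h) in hx.
have [y] := root_pair hx x0; rewrite oppr0 (root_space0 cartan_h) => hy.
by rewrite xh // => /eqP; rewrite eq_sym oner_eq0.
Qed.

Lemma tvecE beta H : killing (vsval (tvec beta)) (vsval H) = beta H.
Proof.
have k0 : lker (killing_map h) = 0%VS.
  apply/eqP; rewrite -subv0; apply/subvP => H'; rewrite memv_ker memv0 => /eqP E.
  apply/eqP/val_inj; apply: cartan_killing_eq0 => /=; first exact: subvsP.
  by move=> y hy; rewrite -(vsprojK hy) -killing_mapE E zero_lfunE.
have kS : limg (killing_map h) = fullv.
  apply/eqP; rewrite eqEdim subvf limg_dim_eq ?k0 ?capv0 //.
  by rewrite !dimvf -[leqRHS]muln1; apply: leqnn.
by rewrite -killing_mapE limg_lfunVK // kS memvf.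
Qed.

Lemma dual_formE beta gamma : dual_form beta gamma = beta (tvec gamma).
Proof. by rewrite -tvecE. Qed.

Lemma dual_formC beta gamma : dual_form beta gamma = dual_form gamma beta.
Proof. exact: killingC. Qed.

Lemma lie_root_opp beta x y : x \in root_space beta -> y \in root_space (- beta) ->
  lie x y = killing x y *: vsval (tvec beta).
Proof.
move=> bx yb; apply/eqP; rewrite -subr_eq0; apply/eqP/cartan_killing_eq0.
  rewrite memvB ?memvZ ?subvsP //.
  by rewrite -(root_space0 cartan_h) -(subrr beta) root_space_lie.
move=> z hz; rewrite -(vsprojK hz) killingC; set H := vsproj h z.
have -> : killing (vsval H) (lie x y - killing x y *: vsval (tvec beta))
    = killing (vsval H) (lie x y) - killing (vsval H) (killing x y *: vsval (tvec beta)).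
  exact: linearB.
rewrite killingZ [killing _ (lie x y)]killingC [killing _ (vsval (tvec _))]killingC.
rewrite tvecE killing_lie lieC (memv_root_space _ _ yb) opp_lfunE scaleNr opprK killingZ.
by rewrite mulrC subrr.
Qed.

Lemma tvec_neq0 beta : beta != 0 -> vsval (tvec beta) != 0.
Proof.
apply: contra_neq => t0; apply/lfunP => H.
by rewrite -tvecE t0 killingC killing0 zero_lfunE.
Qed.

(** With a = (beta, beta), [killing_bracket] reads a = a^2 r with r >= 0, and a is nonzero because
    [tvec beta] is; hence a = 1 / r. *)
Lemma dual_form_gt0 beta : is_root beta -> 0 < dual_form beta beta.
Proof.
case=> b0; rewrite -subv0 => /subvPn[x bx]; rewrite memv0 => x0.
have [y yb xy] := root_pair bx x0.
have [r [r0 + tt0]] := killing_bracket ss cartan_h dualZ b0 bx yb.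
have tE : lie x y = vsval (tvec beta) by rewrite (lie_root_opp bx yb) xy scale1r.
rewrite tE vsvalK -dual_formE -/(dual_form beta beta) expr2 -mulrA => aE.
have a0 : dual_form beta beta != 0.
  by apply: contra_neq (tvec_neq0 b0) => a0; rewrite -tE tt0 // tE.
have ar : dual_form beta beta * r = 1.
  by apply: (mulfI a0); rewrite -aE mulr1.
have r_neq0 : r != 0 by apply: contra_eq_neq ar => ->; rewrite mulr0 eq_sym oner_eq0.
by rewrite -(mulfK r_neq0 (dual_form _ _)) ar mul1r invr_gt0 lt_def r_neq0.
Qed.

Lemma hstable_kperp W : hstable h W -> hstable h (kperp W).
Proof.
move=> hW H x hH /kperpP xW; apply/kperpP => y Wy.
by rewrite lieC -scaleN1r killingZl killing_lie xW ?hW // mulr0.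
Qed.

End RootForm.

(** * Generation by simple root vectors *)

Section SimpleSystem.
Variables (F : numFieldType) (g : lieAlgType F) (h : {vspace g}).
Variables (l : nat) (alpha : 'I_l -> dual h) (Z : 'I_l -> subvs_of h).
Hypotheses (ss : is_semisimple g).
Hypotheses (cartan_h : is_cartan h) (dualZ : is_dual_basis alpha Z).
Implicit Types (x y : g) (U W : {vspace g}) (beta gamma : dual h) (n m : 'I_l -> nat).

Definition has_coords beta n := forall i, beta (Z i) = (n i)%:R :> F.

(** Stated through [alpha] and [Z] alone, so that it survives changing the sign of both ([baseN]);
    results on positive roots then serve for negative ones too. *)
Definition is_base := (forall i, is_root (alpha i)) /\
  forall beta, is_root beta -> exists n, has_coords beta n \/ has_coords (- beta) n.

Hypothesis base : is_base.

(* An X in [g_(- beta)] orthogonal to every [g_(alpha i), g_(beta - alpha i)]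
   is killed by all simple root vectors, so sl2-theory gives
   [(beta, alpha i) <= 0] for all i, contradicting [(beta, beta) > 0]. *)
Lemma root_space_gen beta n W : beta != 0 -> has_coords beta n -> hstable h W ->
  (forall i x y, x \in root_space (alpha i) -> y \in root_space (beta - alpha i) ->
     lie x y \in W) -> (root_space beta <= W)%VS.
Proof.
move=> b0 nb hW bW; apply/subvP => x bx.
have [->|x0] := eqVneq x 0; first exact: mem0v.
have rb : is_root beta.
  by split=> //; rewrite -subv0; apply/subvPn; exists x => //; rewrite memv0.
(* By double orthogonality it suffices that every X orthogonal to W be orthogonal to x; [kperp W] is
   h-stable, so X can be taken of weight -beta. *)
apply: kperp_perp => [|X KX]; first exact: lker_kappa ss cartan_h dualZ.
suff /subvP/(_ X KX)/kperpP : (kperp W <= kperp <[x]>)%VS by apply; apply: memv_line.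
apply: (weight_ind cartan_h dualZ); first exact: hstable_kperp.
move=> {KX}delta {}X /kperpP XW dX; apply/kperpP => _ /vlineP[c ->]; rewrite killingZ.
suff -> : killing X x = 0 by rewrite mulr0.
have [bd|bd] := eqVneq (delta + beta) 0; last exact: (killing_root_space dualZ bd dX bx).
have {bd}dE : delta = - beta by rewrite -(addrK beta delta) bd add0r.
have [->|X0] := eqVneq X 0; first by rewrite killingC killing0.
rewrite dE in dX.
(* A nonzero [e, X] would pair nontrivially with some y in g_(beta - alpha i), but by invariance
   this pairing is, up to sign, that of X with [e, y], an element of W. *)
have Xe i e : e \in root_space (alpha i) -> lie e X = 0.
  move=> ie; apply: contrapT => /eqP eX0.
  have eXs := root_space_lie ie dX.
  have [y] := root_pair ss cartan_h dualZ eXs eX0.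
  rewrite opprB => yb; rewrite lieC -scaleN1r killingZl killing_lie XW ?mulr0; last exact: (bW i).
  by move/eqP; rewrite eq_sym oner_eq0.
have le0 i : dual_form beta (alpha i) <= 0.
  have [a0 +] := base.1 i; rewrite -subv0 => /subvPn[e ie]; rewrite memv0 => e0.
  have [f fi ef] := root_pair ss cartan_h dualZ ie e0.
  have efE := lie_root_opp ss cartan_h dualZ ie fi; rewrite ef scale1r in efE.
  have tE gamma u : u \in root_space gamma ->
      lie (lie e f) u = dual_form gamma (alpha i) *: u.
    by move=> gu; rewrite efE (memv_root_space _ _ gu) (dual_formE ss cartan_h dualZ).
  have form_opp gamma : dual_form (- gamma) (alpha i) = - dual_form gamma (alpha i).
    by rewrite !(dual_formE ss cartan_h dualZ) opp_lfunE.
  have [N [_ _ cN]] : exists N, [/\ iter N (ad f) X != 0, iter N.+1 (ad f) X = 0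
      & 2 * (- dual_form beta (alpha i)) = dual_form (alpha i) (alpha i) * N%:R].
    apply: (@sl2_string _ _ (ad e) (ad f) (ad (lie e f))) => //.
    - by move=> u; rewrite !adE [LHS]lie_lie addrC.
    - move=> u; rewrite !adE [LHS]lie_lie addrC; congr (_ + _).
      by rewrite (tE _ _ fi) form_opp scaleNr lieNl lieZl.
    - by rewrite adE (Xe i).
    - by rewrite adE (tE _ _ dX) form_opp.
    - by apply: (root_space_nilpotent dualZ _ fi dX); rewrite oppr_eq0.
  rewrite -oppr_ge0 -(pmulr_rge0 _ (ltr0n F 2)) cN mulr_ge0 //.
  exact/ltW/(dual_form_gt0 ss cartan_h dualZ)/base.1.
(* Expanding one beta over the simple roots writes (beta, beta) as a sum of terms n i (alpha i,
   beta) <= 0. *)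
have := dual_form_gt0 ss cartan_h dualZ rb; rewrite lt_def => /andP[+ ge0].
rewrite eq_le ge0 andbT (dual_formE ss cartan_h dualZ) {1}(dual_decomp dualZ beta).
rewrite sum_lfunE sumr_le0 // => i _; rewrite scale_lfunE nb mulr_ge0_le0 //.
by rewrite -(dual_formE ss cartan_h dualZ) dual_formC.
Qed.

Lemma alphaZ i j : alpha i (Z j) = (i == j)%:R :> F.
Proof. exact: dualZ.2. Qed.

(** Were beta - alpha i negative, the coefficients of beta and of alpha i - beta would add up to
    those of alpha i, so that beta would be 0 or alpha i. *)
Lemma has_coords_sub beta n i : is_root beta -> has_coords beta n ->
    is_root (beta - alpha i) ->
  exists m, has_coords (beta - alpha i) m /\ forall j, n j = ((i == j) + m j)%N.
Proof.
move=> [b0 _] nb rbi; have [m [mP|mN]] := base.2 _ rbi.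
  exists m; split=> // j; have := mP j.
  rewrite add_lfunE opp_lfunE alphaZ nb => /eqP; rewrite subr_eq addrC -natrD eqr_nat => /eqP.
  by [].
have nm j : (n j + m j = (i == j))%N.
  have := mN j; rewrite !(add_lfunE, opp_lfunE) alphaZ nb opprB => /eqP.
  by rewrite subr_eq addrC -natrD eqr_nat => /eqP ->.
have nj j : i != j -> n j = 0%N.
  by move=> ij; have := nm j; rewrite (negPf ij); case: (n j).
case ni: (n i) (nm i) => [|k] _.
  case/eqP: b0; apply: (dual_eq dualZ) => j; rewrite zero_lfunE nb.
  by have [<-|/nj ->] := eqVneq i j; rewrite ?ni.
case: rbi => /eqP[]; apply: (dual_eq dualZ) => j; apply/eqP.
rewrite zero_lfunE add_lfunE opp_lfunE alphaZ nb subr_eq0 eqr_nat.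
have := nm j; have [<-|/nj ->] //= := eqVneq i j.
by rewrite ni addSn => -[]; case: k {ni}.
Qed.

(** Induction on height with [root_space_gen] built into the step. A root space is only spanned by
    brackets, so instead of decomposing a vector the step offers the inclusion in any h-stable [W]
    containing the brackets. *)
Lemma pos_root_ind (P : dual h -> ('I_l -> nat) -> Prop) :
    (forall i n, (forall j, n j = (i == j)) -> P (alpha i) n) ->
    (forall beta n, is_root beta -> has_coords beta n -> (forall i, beta <> alpha i) ->
       (forall W, hstable h W ->
          (forall i m x y, (forall j, n j = (i == j) + m j)%N -> is_root (beta - alpha i) ->
             has_coords (beta - alpha i) m -> P (beta - alpha i) m ->
             x \in root_space (alpha i) -> y \in root_space (beta - alpha i) ->
             lie x y \in W) ->
          (root_space beta <= W)%VS) -> P beta n) ->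
  forall beta n, is_root beta -> has_coords beta n -> P beta n.
Proof.
move=> Pa Ps beta n; move: {2}(\sum_i n i)%N (leqnn (\sum_i n i)) => k.
elim: k beta n => [|k IHk] beta n nk rb nb; have [b0 _] := rb.
  case/eqP: b0; apply: (dual_eq dualZ) => i; rewrite zero_lfunE nb.
  by move: nk; rewrite leqn0 sum_nat_eq0 => /forallP/(_ i)/eqP ->.
have [[i ba]|nba] := pselect (exists i, beta = alpha i).
  rewrite ba; apply: Pa => j; have := nb j.
  by rewrite ba alphaZ => /eqP; rewrite eqr_nat => /eqP.
apply: Ps => // [i ba|W hW sW]; first by apply: nba; exists i.
apply: (root_space_gen b0 nb hW) => i x y ix y_b.
have [->|y0] := eqVneq y 0; first by rewrite linear0 mem0v.
have rbi : is_root (beta - alpha i).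
  split; first by rewrite subr_eq0; apply/eqP => ba; apply: nba; exists i.
  by rewrite -subv0; apply/subvPn; exists y => //; rewrite memv0.
have [m [mP nm]] := has_coords_sub rb nb rbi.
apply: (sW i m x y) => //; apply: IHk => //.
move: nk; under eq_bigr => j _ do rewrite nm.
rewrite big_split (bigD1 i) //= eqxx big1 => [|j]; last by rewrite eq_sym => /negPf ->.
by rewrite addn0 add1n ltnS.
Qed.

End SimpleSystem.

Section OppositeBase.
Variables (F : numFieldType) (g : lieAlgType F) (h : {vspace g}).
Variables (l : nat) (alpha : 'I_l -> dual h) (Z : 'I_l -> subvs_of h).
Hypotheses (ss : is_semisimple g).
Hypotheses (cartan_h : is_cartan h) (dualZ : is_dual_basis alpha Z).

Let alphaN i := - alpha i.
Let ZN i := - Z i.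

Lemma dual_basisN : is_dual_basis alphaN ZN.
Proof.
split=> [|i j]; last by rewrite opp_lfunE linearN /= opprK dualZ.2.
rewrite basisEdim size_tuple (size_basis dualZ.1) leqnn andbT.
apply/subvP => H _; rewrite (cartan_span dualZ H) memv_suml // => i _.
rewrite memvZ // -[Z i]opprK memvN memv_span //.
by apply/tnthP; exists i; rewrite tnth_mktuple.
Qed.

Lemma baseN : is_base alpha Z -> is_base alphaN ZN.
Proof.
case=> ra base; split=> [i|beta rb]; first exact: (is_rootN ss cartan_h dualZ).
have [n [nP|nP]] := base beta rb; exists n; [right|left] => i.
  by rewrite opp_lfunE linearN /= opprK nP.
by rewrite -nP opp_lfunE linearN.
Qed.

End OppositeBase.

Section Generation.
Variables (F : numFieldType) (g : lieAlgType F) (h : {vspace g}).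
Variables (l : nat) (alpha : 'I_l -> dual h) (Z : 'I_l -> subvs_of h).
Hypotheses (ss : is_semisimple g).
Hypotheses (cartan_h : is_cartan h) (dualZ : is_dual_basis alpha Z).
Hypothesis base : is_base alpha Z.
Implicit Types (x y : g) (U W T : {vspace g}) (beta gamma : dual h) (n m : 'I_l -> nat).

Lemma simple_roots_generate T : is_subalgebra T -> hstable h T ->
    (forall i, root_space (alpha i) <= T)%VS ->
  forall beta n, is_root beta -> has_coords Z beta n -> (root_space beta <= T)%VS.
Proof.
move=> sT hT aT; apply: (pos_root_ind ss cartan_h dualZ base) => [i n _|beta n _ _ _].
  exact: aT.
apply=> // i m x y _ _ _ /subvP bT ix y_b.
exact: sT (subvP (aT i) _ ix) (bT _ y_b).
Qed.

(** In a bracket of g_(alpha i) with g_(beta - alpha i), the second factor lies in T by induction if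
    alpha i0 occurs in beta - alpha i; otherwise i = i0 and the first factor does. *)
Lemma simple_root_module T i0 : hstable h T ->
    (forall beta n x y, is_root beta -> has_coords Z beta n ->
       x \in root_space beta -> y \in T -> lie x y \in T) ->
    (root_space (alpha i0) <= T)%VS ->
  forall beta n, is_root beta -> has_coords Z beta n -> (0 < n i0)%N -> (root_space beta <= T)%VS.
Proof.
move=> hT sT aT; apply: (pos_root_ind ss cartan_h dualZ base) => [i n ni|beta n rb nb _ ind n0].
  by rewrite ni; case: eqP => [-> _|_ h0]; [exact: aT|discriminate h0].
apply: ind => // i m x y nE rbi mb mT ix y_b.
case: (posnP (m i0)) => [m0|/mT/subvP mT']; last first.
  exact: sT (base.1 i) (alphaZ dualZ i) ix (mT' _ y_b).
have ii0 : i = i0 by move: n0; rewrite nE m0; case: eqP.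
rewrite ii0 in ix; rewrite lieC memvN.
exact: sT rbi mb y_b (subvP aT _ ix).
Qed.

End Generation.

(** * Subspaces stable under the negative root spaces *)

Section LowerModules.
Variables (F : numFieldType) (g : lieAlgType F) (h : {vspace g}).
Variables (l : nat) (alpha : 'I_l -> dual h) (Z : 'I_l -> subvs_of h).
Hypotheses (ss : is_semisimple g).
Hypotheses (cartan_h : is_cartan h) (dualZ : is_dual_basis alpha Z).
Hypothesis base : is_base alpha Z.
Implicit Types (x y : g) (U W T A : {vspace g}) (beta gamma : dual h) (n m : 'I_l -> nat).

Let has_coordsN beta n : has_coords Z (- beta) n -> has_coords (fun i => - Z i) beta n.
Proof. by move=> nb i; rewrite -nb opp_lfunE linearN. Qed.

(** The elements mapping A into itself form an h-stable subalgebra, to which generation by simple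
    root spaces applies in the opposite base. *)
Lemma lower_stable A : hstable h A ->
    (forall i x y, x \in root_space (- alpha i) -> y \in A -> lie x y \in A) ->
  forall beta n x y, is_root beta -> has_coords Z (- beta) n ->
    x \in root_space beta -> y \in A -> lie x y \in A.
Proof.
move=> hA aA beta n x y rb /has_coordsN nb bx Ay.
suff /subvP/(_ x bx)/memv_transporter : (root_space beta <= transporter A A)%VS by apply.
apply: (simple_roots_generate ss cartan_h (dual_basisN dualZ)
  (baseN ss cartan_h dualZ base)) nb => //.
- move=> u v /memv_transporter uA /memv_transporter vA; apply/memv_transporter => z Az.
  have -> : lie (lie u v) z = lie u (lie v z) - lie v (lie u z) by rewrite (lie_lie u v z) addrK.
  by rewrite memvB ?uA ?vA ?uA.
- exact: hstable_transporter.
by move=> i; apply/subvP => u ui; apply/memv_transporter => z; apply: aA ui.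
Qed.

(* If the conclusion failed, the orthogonal of A would contain g_(- alpha i),
   hence the lower module it generates, hence g_(- beta), which pairs
   nontrivially with x. *)
Lemma lower_module_simple A beta n x i : hstable h A ->
    (forall i x y, x \in root_space (- alpha i) -> y \in A -> lie x y \in A) ->
    has_coords Z beta n -> beta != 0 -> x \in A -> x \in root_space beta -> x != 0 -> (0 < n i)%N ->
  exists y, [/\ y \in A, y \in root_space (alpha i) & y != 0].
Proof.
move=> hA aA nb b0 Ax bx x0 ni.
apply: contrapT => noy.
have rb : is_root beta.
  by split=> //; rewrite -subv0; apply/subvPn; exists x => //; rewrite memv0.
have [y yb xy] := root_pair ss cartan_h dualZ bx x0.
suff /subvP/(_ y yb)/kperpP/(_ x Ax) : (root_space (- beta) <= kperp A)%VS.
  by rewrite killingC xy => /eqP; rewrite oner_eq0.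
have nbN : has_coords (fun i => - Z i) (- beta) n.
  by move=> j; rewrite opp_lfunE linearN /= opprK nb.
apply: (simple_root_module ss cartan_h (dual_basisN dualZ) (baseN ss cartan_h dualZ base)
  _ _ _ (is_rootN ss cartan_h dualZ rb) nbN ni).
- exact: hstable_kperp.
- move=> gamma m u v rg mg ug /kperpP vA; apply/kperpP => a Aa.
  rewrite lieC -scaleN1r killingZl killing_lie vA ?mulr0 //.
  apply: (lower_stable hA aA rg (n := m)) ug Aa => j.
  by have := mg j; rewrite /= linearN opp_lfunE.
(* Only the part of A of weight alpha i can pair with f, and it is zero by [noy]. *)
- apply/subvP => f fi; apply/kperpP => a Aa.
  suff /subvP/(_ a Aa)/kperpP/(_ f) : (A <= kperp <[f]>)%VS.
    by rewrite killingC; apply; apply: memv_line.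
  apply: (weight_ind cartan_h dualZ) => // gamma u Au gu.
  apply/kperpP => _ /vlineP[c ->]; rewrite killingZ.
  have [gi|gi] := eqVneq (gamma - alpha i) 0; last first.
    by rewrite (killing_root_space dualZ gi gu fi) mulr0.
  have [->|u0] := eqVneq u 0; first by rewrite killingC killing0 mulr0.
  rewrite -(subrK (alpha i) gamma) gi add0r in gu.
  by case: noy; exists u; rewrite Au gu u0.
Qed.

End LowerModules.

(** * Prolongation *)

Section Grading.
Variables (F : numFieldType) (g : lieAlgType F) (E : g).
Implicit Types (x y : g) (i j : int).

(** [grade] unfolds to the case where [E] is the grading element of p. *)
Definition eigen_grading i : {vspace g} := passmx.leigenspace (ad E) i%:~R.
Local Notation gr := eigen_grading.

Lemma gradingP i x : reflect (lie E x = i%:~R *: x) (x \in gr i).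
Proof. by rewrite -adE; apply: memv_leigenspace. Qed.

Lemma grading_lie i j x y : x \in gr i -> y \in gr j -> lie x y \in gr (i + j).
Proof.
move=> /gradingP xi /gradingP yj; apply/gradingP.
by rewrite lie_lie xi yj lieZl linearZ /= -scalerDl intrD.
Qed.

Variable a0 : {vspace g}.
Hypotheses (a0_gr : (a0 <= gr 0)%VS) (a0_sub : is_subalgebra a0).
Local Notation a := (prolong gr a0).

Lemma prolongS (k : nat) : a k.+1 = (gr k.+1 :&: transporter (gr (-1)) (a k))%VS.
Proof. by []. Qed.

Lemma prolong_sub i : (a i <= gr i)%VS.
Proof. by case: i => // -[|k] //; rewrite prolongS capvSl. Qed.

Lemma prolong_down (k : nat) x y : x \in a k.+1 -> y \in gr (-1) -> lie x y \in a k.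
Proof. by rewrite prolongS memv_cap => /andP[_ /memv_transporter]; apply. Qed.

Lemma prolong_lie (k m : nat) x y : x \in a k -> y \in a m -> lie x y \in a (k + m)%N.
Proof.
move: {2}(k + m)%N (leqnn (k + m)) => N; elim: N k m x y => [|N IHN] k m x y.
  by rewrite leqn0 addn_eq0 => /andP[/eqP -> /eqP ->]; apply: a0_sub.
move=> kmN xk ym; case kmE: (k + m)%N => [|r].
  by move: kmE xk ym => /eqP; rewrite addn_eq0 => /andP[/eqP -> /eqP ->]; apply: a0_sub.
rewrite prolongS memv_cap; apply/andP; split.
  rewrite -kmE PoszD; apply: grading_lie; exact: (subvP (prolong_sub _)).
(* For m' = 0 the inner bracket falls into degree -1, outside the reach of the induction; it then
   serves to lower u. *)
have half k' m' u v z : (k' + m' = r.+1)%N -> u \in a k' -> v \in a m' -> z \in gr (-1) ->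
    lie u (lie v z) \in a r.
  move=> km uk vm z1; case: m' km vm => [|m'] km vm.
    move: uk; rewrite addn0 in km; rewrite km => uk; apply: (prolong_down uk).
    by rewrite -[-1]add0r; apply: grading_lie => //; apply: (subvP a0_gr).
  rewrite addnS in km; case: km => rE; rewrite -rE; apply: IHN => //; last exact: prolong_down.
  by rewrite rE -ltnS -kmE.
apply/memv_transporter => z z1.
have -> : lie (lie x y) z = lie x (lie y z) - lie y (lie x z) by rewrite (lie_lie x y z) addrK.
apply: memvB; first exact: half kmE xk ym z1.
by apply: half ym xk z1; rewrite addnC.
Qed.

Lemma prolong_lie0 (k : nat) x y : x \in a0 -> y \in a k -> lie x y \in a k.
Proof. exact: (@prolong_lie 0). Qed.

End Grading.

Lemma memv_sum_leigenspace (F : fieldType) (V : vectType F) (f : 'End(V)) (s : seq F) c x :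
  f x = c *: x -> c \in s -> x \in (\sum_(a <- s) passmx.leigenspace f a)%VS.
Proof.
move=> fx cs; rewrite (big_rem _ cs) (subvP (addvSl _ _)) //.
exact/leigenspaceP.
Qed.

Section Prolongation.
Variables (F : numFieldType) (g : lieAlgType F) (h : {vspace g}).
Variables (l : nat) (alpha : 'I_l -> dual h) (Z : 'I_l -> subvs_of h).
Hypotheses (ss : is_semisimple g).
Hypotheses (cartan_h : is_cartan h) (dualZ : is_dual_basis alpha Z).
Hypothesis base : is_base alpha Z.
Variables (I G : {set 'I_l}) (a0 : {vspace g}).
Implicit Types (x y : g) (U W T A : {vspace g}) (beta gamma : dual h) (n m : 'I_l -> nat).

Local Notation gr := (eigen_grading (vsval (ZS Z I))).
Local Notation a := (prolong gr a0).

(* The properties used of a0 = ann(phi0), with I = I_p and G = {i | <mu, alpha_i> = 0}. *)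
Hypotheses (a0_gr : (a0 <= gr 0)%VS) (a0_sub : is_subalgebra a0) (a0_h : hstable h a0).
Hypothesis a0_neg : forall beta n x, is_root beta -> has_coords Z (- beta) n ->
  x \in root_space beta -> x \in gr 0 -> x \in a0.
Hypothesis a0_tvec : forall i, (vsval (tvec (alpha i)) \in a0) = (i \in G).
Hypothesis a0_simple : forall i, i \in G -> i \notin I -> (root_space (alpha i) <= a0)%VS.

Lemma degreeE beta n (S : {set 'I_l}) : has_coords Z beta n ->
  beta (ZS Z S) = (\sum_(i in S) n i)%N%:R :> F.
Proof.
by move=> nb; rewrite /ZS linear_sum natr_sum; apply: eq_bigr => i _; apply: nb.
Qed.

Lemma root_space_grading beta j x : beta (ZS Z I) = j%:~R :> F ->
  x \in root_space beta -> x \in gr j.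
Proof. by move=> bj /memv_root_space bx; apply/gradingP; rewrite bx bj. Qed.

Lemma root_space_degree beta j x : x \in root_space beta -> x != 0 -> x \in gr j ->
  beta (ZS Z I) = j%:~R :> F.
Proof.
move=> /memv_root_space bx x0 /gradingP; rewrite bx => /eqP.
by rewrite -subr_eq0 -scalerBl scaler_eq0 (negPf x0) orbF subr_eq0 => /eqP.
Qed.

Lemma simple_degree i : alpha i (ZS Z I) = (i \in I)%:R :> F.
Proof.
rewrite (@degreeE _ (fun j => (i == j))) => [|j]; last exact: alphaZ.
have [iI|iI] := boolP (i \in I).
  by rewrite (bigD1 i) //= eqxx big1 // => j /andP[_]; rewrite eq_sym => /negPf ->.
by rewrite big1 // => j jI; case: eqVneq => // ij; rewrite ij jI in iI.
Qed.

Lemma hstable_grading j : hstable h (gr j).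
Proof.
move=> H x hH /gradingP jx; apply/gradingP.
have E0 : lie (vsval (ZS Z I)) H = 0.
  by case: cartan_h => ab _ _; apply: ab => //; apply: subvsP.
by rewrite lie_lie E0 lie0 add0r jx linearZ.
Qed.

Lemma hstable_prolong (k : nat) : hstable h (a k).
Proof.
elim: k => [|k IHk]; first exact: a0_h.
rewrite prolongS; apply: hstable_cap; first exact: hstable_grading.
by apply: hstable_transporter => //; apply: hstable_grading.
Qed.

Lemma prolong_support (k : nat) beta n x i : x \in a k -> x \in root_space beta -> x != 0 ->
  beta != 0 -> has_coords Z beta n -> (0 < n i)%N -> i \in G.
Proof.
move=> kx bx x0 b0 nb ni.
have [s sP] := weights_finite cartan_h dualZ.
pose neg beta := (beta (ZS Z I) : F) < 0.
pose L := (\sum_(b <- s | neg b) root_space b)%VS.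
(* A truncation of the prolongation, with all root spaces of negative degree gathered in [L]. The
   bound k + 2 keeps degree 1 even when k = 0, since alpha i may have degree 1. *)
pose A := (L + \sum_(j < k.+2) a (j : nat))%VS.
have hL : hstable h L by apply: hstable_sum => b _; apply: hstable_root_space.
have hA : hstable h A.
  by apply: hstable_add => //; apply: hstable_sum => j _; apply: hstable_prolong.
have negL gamma y : neg gamma -> y \in root_space gamma -> y \in L.
  move=> ng gy; have [->|y0] := eqVneq y 0; first exact: mem0v.
  have gs : gamma \in s.
    by apply: sP; rewrite -subv0; apply/subvPn; exists y => //; rewrite memv0.
  by rewrite /L (big_rem _ gs) /= ng (subvP (addvSl _ _)).
have LA : (L <= A)%VS by apply: addvSl.
have aA (j : nat) y : (j < k.+2)%N -> y \in a j -> y \in A.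
  move=> jk jy; apply: (subvP (addvSr _ _)).
  by rewrite (bigD1 (Ordinal jk)) //= (subvP (addvSl _ _)).
have gr1L : (gr (-1) <= L)%VS.
  apply: (weight_ind cartan_h dualZ) => [|gamma y y1 gy]; first exact: hstable_grading.
  have [->|y0] := eqVneq y 0; first exact: mem0v.
  apply: (negL _ _ _ gy); rewrite /neg (root_space_degree gy y0 y1).
  by rewrite mulrN1z oppr_lt0 ltr01.
have simple_gr j y : y \in root_space (- alpha j) -> y \in gr (- (j \in I)%:Z).
  by apply: root_space_grading; rewrite opp_lfunE simple_degree mulrNz.
have downA j y z : y \in root_space (- alpha j) -> z \in A -> lie y z \in A.
  move=> jy; suff /subvP sA : (A <= ad y @^-1: A)%VS by move/sA; rewrite -memv_preim adE.
  rewrite subv_add; apply/andP; split.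
    apply: (big_ind (fun U => (U <= ad y @^-1: A)%VS)) => [|U W|gamma ng].
    - exact: sub0v.
    - by rewrite subv_add => -> ->.
    apply/subvP => u gu; rewrite -memv_preim adE; apply: (subvP LA).
    apply: (negL (- alpha j + gamma)); last exact: root_space_lie.
    rewrite /neg add_lfunE opp_lfunE simple_degree.
    by apply: le_lt_trans ng; rewrite -[leRHS]add0r lerD2r oppr_le0 ler0n.
  apply/subv_sumP => -[r rk] _ /=; apply/subvP => u ru; rewrite -memv_preim adE.
  (* For j in I the degree drops by one, from degree 0 into [L]; for the other j, g_(- alpha j) has
     degree 0 and lies in [a0]. *)
  have [jI|jI] := boolP (j \in I).
    have := simple_gr _ _ jy; rewrite jI => y1; rewrite lieC memvN.
    case: r rk ru => [|r] rk ru.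
      apply/(subvP LA)/(subvP gr1L); rewrite -[-1]add0r; apply: grading_lie => //.
      exact: (subvP a0_gr).
    by apply: (aA r); [apply: ltnW|apply: prolong_down].
  apply: (aA r) => //; apply: prolong_lie0 => //.
  have := simple_gr _ _ jy; rewrite (negPf jI) oppr0 => y0.
  apply: (a0_neg (beta := - alpha j) (n := fun i => (j == i))) => //.
    exact/(is_rootN ss cartan_h dualZ)/base.1.
  by move=> i'; rewrite opprK alphaZ.
have [Y [AY iY Y0]] := lower_module_simple ss cartan_h dualZ base hA downA nb b0
  (aA _ _ (leqW (leqnn k.+1)) kx) bx x0 ni.
have [f fi Yf] := root_pair ss cartan_h dualZ iY Y0.
have tE := lie_root_opp ss cartan_h dualZ iY fi; rewrite Yf scale1r in tE.
pose d := nat_of_bool (i \in I).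
have Yd : Y \in gr d by apply: root_space_grading iY; rewrite simple_degree.
have dk : (d < k.+2)%N by rewrite /d; case: (i \in I).
(* Y lies in the sum A and must be placed in its summand of degree d. The difference of Y and its
   component there has eigenvalue d, yet lies in a sum of eigenspaces for other eigenvalues, so it
   is zero. *)
have {AY}Yad : Y \in a d.
  case/memv_addP: AY => u Lu [_ /memv_sumP[v va ->] YE].
  have vd : v (Ordinal dk) \in a d by apply: va.
  suff /eqP : Y - v (Ordinal dk) = 0 by rewrite subr_eq0 => /eqP ->.
  pose dg (b : dual h) : F := b (ZS Z I).
  pose t := [seq dg b | b <- s & neg b] ++
    [seq (nat_of_ord j)%:R | j <- enum 'I_k.+2 & j != Ordinal dk].
  apply: (@sum_leigenspace_eq0 _ _ (ad (vsval (ZS Z I))) t d%:~R).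
  - rewrite YE (bigD1 (Ordinal dk)) //= addrCA [_ - v _]addrC addKr memvD //.
      move: u Lu {YE}; apply/subvP.
      rewrite /L -big_filter big_seq.
      apply: (big_ind (fun U => (U <= _)%VS)) => [|U W|gamma]; rewrite ?sub0v //.
        by rewrite subv_add => -> ->.
      move=> gs; apply/subvP => u /memv_root_space gu.
      apply: (memv_sum_leigenspace (c := gamma (ZS Z I))); first by rewrite adE gu.
      by rewrite mem_cat; apply/orP; left; apply: (map_f dg).
    apply: memv_suml => j jd; apply: (memv_sum_leigenspace (c := (nat_of_ord j)%:R)).
      by rewrite adE pmulrn; apply/gradingP/(subvP (prolong_sub a0_gr _))/va.
    rewrite mem_cat; apply/orP; right; apply/mapP; exists j => //.
    by rewrite mem_filter jd mem_enum.
  - by rewrite adE; apply/gradingP; rewrite memvB // (subvP (prolong_sub a0_gr _)).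
  rewrite mem_cat negb_or; apply/andP; split; apply/mapP => -[b].
    rewrite mem_filter => /andP[negb _] E; have : dg b < 0 := negb.
    by rewrite -E => /lt_geF; rewrite ler0z.
  rewrite mem_filter => /andP[+ _] /eqP; rewrite -pmulrn eqr_nat => + /eqP E.
  by rewrite -val_eqE /= E eqxx.
rewrite -a0_tvec -tE.
have := simple_gr _ _ fi; move: Yad; rewrite /d; case: (boolP (i \in I)) => iI Yad f1.
  exact: (prolong_down Yad f1).
apply: a0_sub => //; apply: (a0_neg (beta := - alpha i) (n := fun j => (i == j))) => //.
  exact/(is_rootN ss cartan_h dualZ)/base.1.
by move=> j; rewrite opprK alphaZ.
Qed.

(** The truth value is the degree of alpha i. In degree 1, bracket with a vector of degree -1, whose
    weight gamma is a negative root: if gamma = - alpha i, the result is a multiple of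
    [tvec (alpha i)]; otherwise alpha i + gamma, if a root, is negative of degree 0. *)
Lemma simple_prolong i : i \in G -> (root_space (alpha i) <= a (i \in I))%VS.
Proof.
move=> iG; have [iI|iI] := boolP (i \in I); last exact: a0_simple.
apply/subvP => e ie; rewrite prolongS memv_cap; apply/andP; split.
  by apply: root_space_grading ie; rewrite simple_degree iI.
apply/memv_transporter => y0 y01.
suff /subvP/(_ y0 y01) : (gr (-1) <= ad e @^-1: a0)%VS by rewrite -memv_preim adE.
apply: (weight_ind cartan_h dualZ) => [|gamma y y1 gy]; first exact: hstable_grading.
rewrite -memv_preim adE.
have [->|ey0] := eqVneq (lie e y) 0; first exact: mem0v.
have yn0 : y != 0 by apply: contra_neq ey0 => ->; rewrite linear0.
have gdeg := root_space_degree gy yn0 y1.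
have rg : is_root gamma.
  split; last by rewrite -subv0; apply/subvPn; exists y => //; rewrite memv0.
  apply: contra_eq_neq gdeg => ->; rewrite zero_lfunE mulrN1z eq_sym oppr_eq0.
  exact: oner_neq0.
have [m [mg|mg]] := base.2 _ rg.
  have := degreeE I mg; rewrite gdeg => /eqP; rewrite mulrN1z eq_sym -subr_eq0 opprK.
  by rewrite natr1 pnatr_eq0.
have [ag|ag] := eqVneq (alpha i + gamma) 0.
  have gE : gamma = - alpha i by rewrite -(addKr (alpha i) gamma) ag addr0.
  rewrite gE in gy; rewrite (lie_root_opp ss cartan_h dualZ ie gy) memvZ //.
  by rewrite a0_tvec.
have eys := root_space_lie ie gy.
have ra : is_root (alpha i + gamma).
  by split=> //; rewrite -subv0; apply/subvPn; exists (lie e y) => //; rewrite memv0.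
have ey_gr : lie e y \in gr 0.
  rewrite -[0](subrr 1); apply: grading_lie => //.
  by apply: root_space_grading ie; rewrite simple_degree iI.
have [r [rP|rP]] := base.2 _ ra; last exact: a0_neg ra rP eys ey_gr.
(* Were alpha i + gamma positive, its coefficients and those of - gamma would add up to those of
   alpha i, and - gamma, having degree 1, would be alpha i itself. *)
have mr j : (m j + r j = (i == j))%N.
  apply/eqP; rewrite -(eqr_nat F) natrD -mg -rP -(alphaZ dualZ) add_lfunE opp_lfunE.
  by rewrite addrCA addNr addr0.
have mj j : i != j -> m j = 0%N.
  by move=> ij; have := mr j; rewrite (negPf ij); case: (m j).
have mi : m i = 1%N.
  have := degreeE I mg; rewrite opp_lfunE gdeg mulrN1z opprK (bigD1 i) //=.
  rewrite big1 => [|j /andP[_ ji]]; last by rewrite mj // eq_sym.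
  by move/eqP; rewrite addn0 eq_sym pnatr_eq1 => /eqP.
case/eqP: ag; apply: (dual_eq dualZ) => j; rewrite zero_lfunE rP.
have := mr j; case: eqVneq => [<-|ij]; last by rewrite mj // add0n => ->.
by rewrite mi add1n => [[->]].
Qed.

Lemma prolong_root_space beta n : is_root beta -> has_coords Z beta n ->
  (forall i, (0 < n i)%N -> i \in G) -> (root_space beta <= a (\sum_(i in I) n i)%N)%VS.
Proof.
move: beta n; apply: (pos_root_ind ss cartan_h dualZ base) => [i n ni nG|beta n rb nb _ ind nG].
  have -> : (\sum_(j in I) n j)%N = (i \in I).
    apply/eqP; rewrite -(eqr_nat F) -simple_degree eq_sym.
    by apply/eqP; apply: degreeE => j; rewrite ni; apply: alphaZ.
  by apply: simple_prolong; apply: nG; rewrite ni eqxx.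
apply: ind => [|i m x y nE rbi mb mG ix y_b]; first exact: hstable_prolong.
have -> : (\sum_(j in I) n j = (i \in I) + \sum_(j in I) m j)%N.
  apply/eqP; rewrite -(eqr_nat F) natrD -simple_degree -(degreeE I mb) -(degreeE I nb).
  by rewrite add_lfunE opp_lfunE addrC subrK.
apply: prolong_lie => //; last first.
  by apply: (subvP (mG _)) y_b => j mj; apply: nG; rewrite nE addn_gt0 mj orbT.
by apply: (subvP (simple_prolong _)) ix; apply: nG; rewrite nE eqxx.
Qed.

Lemma positive_degree_coords (k : nat) beta : is_root beta -> (0 < k)%N ->
  beta (ZS Z I) = k%:R :> F -> exists n, has_coords Z beta n.
Proof.
move=> rb k0 bk; have [n [nb|nb]] := base.2 _ rb; first by exists n.
have := degreeE I nb; rewrite opp_lfunE bk => /eqP.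
by rewrite eq_sym -addr_eq0 -natrD pnatr_eq0 addn_eq0 (gtn_eqF k0) andbF.
Qed.

Lemma prolong_rootsP (k : nat) beta : (0 < k)%N -> roots_of (a k) beta <->
  exists n, [/\ is_root beta, beta (ZS Z I) = k%:R :> F, has_coords Z beta n
              & forall i, (0 < n i)%N -> i \in G].
Proof.
move=> k0; split=> [[rb /subvP bk]|[n [rb bk nb nG]]]; last first.
  split=> //; move: bk; rewrite (degreeE I nb) => /eqP; rewrite eqr_nat => /eqP <-.
  exact: prolong_root_space.
have [b0 +] := rb; rewrite -subv0 => /subvPn[x bx]; rewrite memv0 => x0.
have xk := bk _ bx.
have bdeg := root_space_degree bx x0 (subvP (prolong_sub a0_gr _) _ xk).
have [n nb] := positive_degree_coords rb k0 bdeg.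
by exists n; split=> // i; apply: prolong_support xk bx x0 b0 nb.
Qed.

(** One nonzero vector confines the support of beta to G ([prolong_support]), and this in turn puts
    the whole root space into [a k]. *)
Lemma prolong_weight_root (k : nat) beta x : (0 < k)%N -> x \in a k ->
  x \in root_space beta -> x != 0 -> roots_of (a k) beta.
Proof.
move=> k0 xk bx x0.
have bdeg := root_space_degree bx x0 (subvP (prolong_sub a0_gr _) _ xk).
have b0 : beta != 0.
  by apply: contra_eq_neq bdeg => ->; rewrite zero_lfunE eq_sym -pmulrn pnatr_eq0 -lt0n.
have rb : is_root beta.
  by split=> //; rewrite -subv0; apply/subvPn; exists x => //; rewrite memv0.
have [n nb] := positive_degree_coords rb k0 bdeg.
apply/(prolong_rootsP _ k0); exists n; split=> // i.
exact: prolong_support xk bx x0 b0 nb.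
Qed.

Lemma prolong_ind (k : nat) W : (0 < k)%N ->
  (forall beta, roots_of (a k) beta -> (root_space beta <= W)%VS) -> (a k <= W)%VS.
Proof.
move=> k0 aW; apply: (weight_ind cartan_h dualZ) => [|beta x xk bx]; first exact: hstable_prolong.
have [->|x0] := eqVneq x 0; first exact: mem0v.
exact: (subvP (aW _ (prolong_weight_root k0 xk bx x0))).
Qed.

Lemma prolong_sum_root_spaces (k : nat) : (0 < k)%N ->
  exists (n : nat) (beta : 'I_n -> dual h),
    [/\ injective beta, forall i, is_root (beta i),
        directv (\sum_(i < n) root_space (beta i))%VS
      & a k = (\sum_(i < n) root_space (beta i))%VS].
Proof.
move=> k0; have [s sP] := weights_finite cartan_h dualZ.
pose t := undup [seq b <- s | `[< roots_of (a k) b >]].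
pose b (i : 'I_(size t)) := t`_i.
have bt i : roots_of (a k) (b i).
  have : b i \in t by apply: mem_nth.
  by rewrite mem_undup mem_filter => /andP[/asboolP].
have bI : injective b.
  by move=> i j /eqP; rewrite nth_uniq ?undup_uniq // => /eqP/val_inj.
exists (size t), b; split=> // [i||]; first exact: (bt i).1.
  apply/directv_sumP => i _; apply/eqP; rewrite -subv0; apply/subvP => x.
  rewrite memv_cap => /andP[ix xs].
  suff -> : x = 0 by apply: mem0v.
  apply: (sum_root_space_eq0 cartan_h dualZ xs ix) => j ji.
  by apply: contraNneq ji => /bI ->.
apply/eqP; rewrite eqEsubv; apply/andP; split; last by apply/subv_sumP => i _; exact: (bt i).2.
apply: prolong_ind => // beta rb.
have bT : beta \in t.
  rewrite mem_undup mem_filter; apply/andP; split; first exact/asboolP.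
  by apply: sP; case: rb => -[].
have it : (index beta t < size t)%N by rewrite index_mem.
have -> : beta = b (Ordinal it) by rewrite /b nth_index.
by rewrite (bigD1 (Ordinal it)) // addvSl.
Qed.

(** Index k means k + 1 nested factors, so it sits in degree k + 1. *)
Fixpoint iter_bracket (k : nat) : {vspace g} :=
  if k is k'.+1 then liev (a 1) (iter_bracket k') else a 1.

Lemma iter_bracket_stable x (k : nat) y : (forall z, z \in a 1 -> lie x z \in a 1) ->
  y \in iter_bracket k -> lie x y \in iter_bracket k.
Proof.
move=> xa1; elim: k y => [|k IHk] y; first exact: xa1.
suff /subvP sD : (iter_bracket k.+1 <= ad x @^-1: iter_bracket k.+1)%VS.
  by move/sD; rewrite -memv_preim adE.
have inD u v : u \in a 1 -> v \in iter_bracket k -> lie u v \in iter_bracket k.+1.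
  by move: u v; apply/(liev_subP _ _ (iter_bracket k.+1)); apply: subvv.
apply/liev_subP => u v ua vD; rewrite -memv_preim adE lie_lie; apply: memvD.
  exact: inD (xa1 _ ua) vD.
exact: inD ua (IHk _ vD).
Qed.

(* Adding simple roots one at a time: a root vector of [alpha i], i in I, lies
   in [a 1], and the other ones act on [a 1] since they lie in [a0]. *)
Lemma prolong_iter_bracket (k : nat) : (a k.+1 <= iter_bracket k)%VS.
Proof.
apply: prolong_ind => // beta /(prolong_rootsP _ (ltn0Sn k))[n [rb bk nb nG]].
have nk : (\sum_(i in I) n i)%N = k.+1.
  by move: bk; rewrite (degreeE I nb) => /eqP; rewrite eqr_nat => /eqP.
clear bk; move: beta n rb nb nG k nk.
apply: (pos_root_ind ss cartan_h dualZ base (P := fun beta n =>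
  (forall i, (0 < n i)%N -> i \in G) -> forall k, (\sum_(i in I) n i)%N = k.+1 ->
  (root_space beta <= iter_bracket k)%VS)) => [i n ni nG k nk|beta n rb nb _ ind nG k nk].
  have E : (\sum_(j in I) n j)%N = (i \in I).
    apply/eqP; rewrite -(eqr_nat F) -simple_degree eq_sym.
    by apply/eqP; apply: degreeE => j; rewrite ni; apply: alphaZ.
  have := simple_prolong (nG i _); rewrite ni eqxx => /(_ isT).
  by rewrite -E nk; move: nk; rewrite E; case: (i \in I) => // -[<-].
case: k nk => [|k] nk.
  by have := prolong_root_space rb nb nG; rewrite nk.
apply: ind => [H x hH xD|i m x y nE rbi mb mD ix y_b].
  by apply: iter_bracket_stable xD => z za; apply: hstable_prolong za.
have iG : i \in G by apply: nG; rewrite nE eqxx.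
have mG j : (0 < m j)%N -> j \in G by move=> mj; apply: nG; rewrite nE addn_gt0 mj orbT.
have mk : ((i \in I) + \sum_(j in I) m j = k.+2)%N.
  apply/eqP; rewrite -nk -(eqr_nat F) natrD -simple_degree -(degreeE I mb) -(degreeE I nb).
  by rewrite add_lfunE opp_lfunE addrC subrK.
have xa := subvP (simple_prolong iG) _ ix.
case: (i \in I) mk xa => [] mk xa.
  case: mk => mk; have yD := subvP (mD mG k mk) _ y_b.
  by move: x y xa yD {ix y_b}; apply/(liev_subP _ _ (iter_bracket k.+1)); apply: subvv.
have yD := subvP (mD mG k.+1 mk) _ y_b.
by apply: iter_bracket_stable yD => z za; apply: prolong_lie0.
Qed.

Lemma iter_bracket_sub U (k : nat) :
  is_subalgebra U -> (a 1 <= U)%VS -> (iter_bracket k <= U)%VS.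
Proof.
move=> sU aU; elim: k => [|k IHk] //.
apply/liev_subP => x y xa yD; apply: sU; [exact: (subvP aU)|exact: (subvP IHk)].
Qed.

Lemma lie_gen_prolong : lie_gen [set` a 1]%classic = positive_part a.
Proof.
pose U N := (\sum_(1 <= k < N) a k)%VS.
have aUN (k N : nat) : (0 < k < N)%N -> (a k <= U N)%VS.
  by move=> kN; rewrite /U (big_rem k) ?mem_index_iota //= addvSl.
have UW N W : (forall k : nat, (0 < k)%N -> (a k <= W)%VS) -> (U N <= W)%VS.
  move=> aW; rewrite /U big_seq; apply: (big_ind (fun V => (V <= W)%VS)) => [|V V'|k].
  - exact: sub0v.
  - by rewrite subv_add => -> ->.
  - by rewrite mem_index_iota => /andP[k0 _]; apply: aW.
(* The partial sums increase in a finite-dimensional space; one of maximal dimension contains all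
   the others, so the positive part is a subspace and can be tested as a subalgebra. *)
have [N UN] : exists N, forall m : nat, (U m <= U N)%VS.
  have exd : exists d, `[< exists n : nat, \dim (U n) = d >].
    by exists (\dim (U 0)); apply/asboolP; exists 0%N.
  have led d : `[< exists n : nat, \dim (U n) = d >] -> (d <= \dim {:g})%N.
    by move=> /asboolP[n <-]; apply: dimvS (subvf _).
  case: (ex_maxnP exd led) => d /asboolP[N dN] dmax; exists N => m.
  have leU (n n' : nat) : (n <= n')%N -> (U n <= U n')%VS.
    move=> nn'; rewrite /U big_seq; apply: (big_ind (fun V => (V <= U n')%VS)) => [|V V'|k].
    - exact: sub0v.
    - by rewrite subv_add => -> ->.
    - by rewrite mem_index_iota => /andP[k0 kn]; apply: aUN; rewrite k0 (leq_trans kn).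
  have /eqP -> : U N == U (maxn m N).
    rewrite eqEdim leU ?leq_maxr //= dN; apply: dmax; apply/asboolP; by exists (maxn m N).
  exact: leU (leq_maxl _ _).
have aU (k : nat) : (0 < k)%N -> (a k <= U N)%VS.
  by move=> k0; apply: subv_trans (UN k.+1); apply: aUN; rewrite k0 /=.
apply/seteqP; split=> [x|x [n xn] W sW aW].
  move=> /(_ (U N)) xU; exists N; apply: xU => [|z za]; last exact: (subvP (aU 1%N isT)).
  move=> y z yU; move: y yU z; suff sU : (U N <= transporter (U N) (U N))%VS.
    by move=> y /(subvP sU)/memv_transporter.
  apply: (UW) => k k0; apply/subvP => y ya; apply/memv_transporter => z zU.
  suff /subvP/(_ z zU) : (U N <= ad y @^-1: U N)%VS by rewrite -memv_preim adE.
  apply: UW => m m0; apply/subvP => {zU}z za; rewrite -memv_preim adE.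
  by apply: (subvP (aU (k + m)%N _)); [rewrite addn_gt0 k0|apply: prolong_lie].
suff /subvP : (U n <= W)%VS by apply.
apply: UW => -[|k] // _; apply: subv_trans (prolong_iter_bracket k) _.
by apply: iter_bracket_sub => //; apply/subvP => z /aW.
Qed.

End Prolongation.

(** * Lowest weight vectors *)

Section LowestWeight.
Variables (F : numFieldType) (g : lieAlgType F) (h b : {vspace g}).
Variables (l : nat) (alpha : 'I_l -> dual h) (Z : 'I_l -> subvs_of h).
Hypotheses (ss : is_semisimple g).
Hypotheses (cartan_h : is_cartan h) (dualZ : is_dual_basis alpha Z).
Hypothesis simple_alpha : is_simple_system b alpha.
Implicit Types (x y : g) (beta gamma : dual h) (n m : 'I_l -> nat).

Lemma has_coords_sum n : has_coords Z (\sum_i alpha i *+ n i) n.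
Proof.
move=> i; rewrite -(dual_sum_coord dualZ (fun j => (n j)%:R) i).
by under [in RHS]eq_bigr => j _ do rewrite scaler_nat.
Qed.

Lemma simple_system_base : is_base alpha Z.
Proof.
case: simple_alpha => _ ab bpos bneg; split=> [i|beta rb]; first exact: (ab i).1.
have [bb|nbb] := pselect (roots_of b beta).
  by have [n ->] := bpos beta bb; exists n; left; apply: has_coords_sum.
by have [n ->] := bneg beta rb nbb; exists n; right; rewrite opprK; apply: has_coords_sum.
Qed.

Lemma positive_root_borel beta n : is_root beta -> has_coords Z beta n -> roots_of b beta.
Proof.
move=> rb nb; apply: contrapT => nbb.
case: simple_alpha => _ _ _ bneg; have [m bE] := bneg beta rb nbb.
case: rb => /eqP[]; apply: (dual_eq dualZ) => i; rewrite zero_lfunE nb.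
have := nb i; rewrite bE opp_lfunE has_coords_sum => /eqP.
by rewrite eq_sym -addr_eq0 -natrD pnatr_eq0 addn_eq0 => /andP[/eqP ->].
Qed.

Variables (I : {set 'I_l}) (mu : dual h) (V : vectType F).
Local Notation gr := (eigen_grading (vsval (ZS Z I))).
Variables (rho : 'Hom(subvs_of (gr 0), 'End(V))) (phi : V).
Hypotheses (rep_rho : is_representation rho) (low_phi : is_lowest_weight_vector rho b mu phi).

Local Notation act x := (rho (vsproj (gr 0) x)).

Let phi_neq0 : phi != 0. Proof. by case: low_phi. Qed.

Lemma cartan_gr0 x : x \in h -> x \in gr 0.
Proof.
move=> hx; apply/gradingP; rewrite scale0r.
by case: cartan_h => ab _ _; apply: ab => //; apply: subvsP.
Qed.

Lemma gr0_lie x y : x \in gr 0 -> y \in gr 0 -> lie x y \in gr 0.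
Proof. by rewrite -[X in _ -> _ -> _ \in gr X]addr0; apply: grading_lie. Qed.

Lemma act_lie x y w : x \in gr 0 -> y \in gr 0 ->
  act (lie x y) w = act x (act y w) - act y (act x w).
Proof.
move=> x0 y0; have := rep_rho (vsproj (gr 0) x) (vsproj (gr 0) y).
by rewrite !vsprojK // => ->; rewrite add_lfunE opp_lfunE !comp_lfunE.
Qed.

Lemma act_cartan x : x \in h -> act x phi = (mu (vsproj h x) : F) *: phi.
Proof. by move=> hx; case: low_phi => _ + _ => /(_ (vsproj h x)); rewrite vsprojK. Qed.

Lemma ann_gr0 : (ann rho phi <= gr 0)%VS.
Proof. by apply/subvP => x /memv_ann[]. Qed.

Lemma ann_subalgebra : is_subalgebra (ann rho phi).
Proof.
move=> x y /memv_ann[x0 xp] /memv_ann[y0 yp]; apply/memv_ann; split; first exact: gr0_lie.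
by rewrite act_lie // xp yp !linear0 addr0.
Qed.

Lemma hstable_ann : hstable h (ann rho phi).
Proof.
move=> H x hH /memv_ann[x0 xp]; have H0 := cartan_gr0 hH.
apply/memv_ann; split; first exact: gr0_lie.
by rewrite act_lie // xp linear0 act_cartan // linearZ /= xp scaler0 subrr.
Qed.

Lemma ann_negative beta n x : is_root beta -> has_coords Z (- beta) n ->
  x \in root_space beta -> x \in gr 0 -> x \in ann rho phi.
Proof.
move=> rb nb bx x0; apply/memv_ann; split=> //.
rewrite -[beta]opprK in bx; case: low_phi => _ _ low.
exact: low (positive_root_borel (is_rootN ss cartan_h dualZ rb) nb) bx x0.
Qed.

Lemma ann_tvec i :
  (vsval (tvec (alpha i)) \in ann rho phi) = (i \in [set j | dual_form mu (alpha j) == 0]).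
Proof.
have ht : vsval (tvec (alpha i)) \in h by apply: subvsP.
rewrite inE (dual_formE ss cartan_h dualZ); apply/memv_ann/eqP => [[_]|E].
  rewrite act_cartan // vsvalK => /eqP.
  by rewrite scaler_eq0 (negPf phi_neq0) orbF => /eqP.
split; first exact: cartan_gr0.
by rewrite act_cartan // vsvalK E scale0r.
Qed.

(* phi is a lowest weight vector of weight 0 for the sl2 of [alpha i], so the
   raising operator kills it, V being finite-dimensional. *)
Lemma ann_simple i : i \in [set j | dual_form mu (alpha j) == 0] -> i \notin I ->
  (root_space (alpha i) <= ann rho phi)%VS.
Proof.
rewrite inE (dual_formE ss cartan_h dualZ) => /eqP mu0 iI.
apply/subvP => e ie; have [->|e0] := eqVneq e 0; first exact: mem0v.
have [f fi ef] := root_pair ss cartan_h dualZ ie e0.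
have tE := lie_root_opp ss cartan_h dualZ ie fi; rewrite ef scale1r in tE.
have deg0 := simple_degree dualZ I i; rewrite (negPf iI) in deg0.
have e_gr : e \in gr 0 by apply: root_space_grading ie.
have f_gr : f \in gr 0.
  by apply: root_space_grading fi; rewrite opp_lfunE deg0 oppr0.
set t := lie e f in tE; have t_gr : t \in gr 0 by apply: gr0_lie.
have ht : t \in h by rewrite tE subvsP.
have tphi : act t phi = 0 by rewrite act_cartan // tE vsvalK mu0 scale0r.
pose c : F := dual_form (alpha i) (alpha i).
have c0 : c != 0.
  by rewrite gt_eqF // (dual_form_gt0 ss cartan_h dualZ) //; apply: simple_system_base.1.
have te : lie t e = c *: e.
  by rewrite tE (memv_root_space _ _ ie) -(dual_formE ss cartan_h dualZ).
have act_te w : act t (act e w) = act e (act t w) + c *: act e w.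
  have := act_lie w t_gr e_gr; rewrite te !linearZ /= scale_lfunE => ->.
  by rewrite addrC subrK.
have actn (n : nat) : act t (iter n (act e) phi) = (c * n%:R) *: iter n (act e) phi.
  elim: n => [|n IHn]; first by rewrite tphi mulr0 scale0r.
  by rewrite iterS act_te IHn linearZ /= -scalerDl mulrSr mulrDr mulr1.
(* The iterates are eigenvectors of [act t] for the distinct eigenvalues c n. *)
have nilp : exists n : nat, iter n (act e) phi = 0.
  apply: (eigenvector_seq_eq0 (c := fun n : nat => c * n%:R)) actn => m n /(mulfI c0)/eqP.
  by rewrite eqr_nat => /eqP.
have [N [_ eN cN]] : exists N : nat, [/\ iter N (act e) phi != 0, iter N.+1 (act e) phi = 0
    & 2 * 0 = c * N%:R].
  (* The roles of e and f are exchanged: f kills phi, and [f, e] = -t acts on it by 0, so the string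
     has length N = 0. *)
  apply: (@sl2_string _ _ (act f) (act e) (act (lie f e))) => //.
  - by move=> w; rewrite act_lie // addrC subrK.
  - move=> w; rewrite lieC linearN /= linearN /= !opp_lfunE -/t act_te opprD.
    by rewrite linearN.
  - have rb := is_rootN ss cartan_h dualZ (simple_system_base.1 i).
    suff /memv_ann[] : f \in ann rho phi by [].
    apply: (ann_negative rb (n := fun j => (i == j))) => // j.
    by rewrite opprK (alphaZ dualZ).
  - by rewrite lieC linearN /= linearN /= opp_lfunE tphi oppr0 scale0r.
move/eqP: cN; rewrite mulr0 eq_sym mulf_eq0 (negPf c0) pnatr_eq0 => /eqP N0.
by apply/memv_ann; split=> //; rewrite N0 in eN.
Qed.

End LowestWeight.

(** * Reading the claims off the support criterion *)

Local Open Scope classical_set_scope.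

Lemma dual_form_coroot_eq0 (F : numFieldType) (g : lieAlgType F) (h : {vspace g})
    (l : nat) (alpha : 'I_l -> dual h) (Z : 'I_l -> subvs_of h) (mu beta : dual h) :
  is_semisimple g -> is_cartan h -> is_dual_basis alpha Z -> is_root beta ->
  (dual_form mu (coroot beta) == 0) = (dual_form mu beta == 0).
Proof.
move=> ss cartan_h dualZ rb.
rewrite [LHS](_ : _ = (dual_form (coroot beta) mu == 0)); last by rewrite dual_formC.
rewrite (dual_formE ss cartan_h dualZ) scale_lfunE -(dual_formE ss cartan_h dualZ).
rewrite mulf_eq0 dual_formC mulf_eq0 invr_eq0 pnatr_eq0 /=.
by rewrite gt_eqF // (dual_form_gt0 ss cartan_h dualZ).
Qed.

Theorem theorem3p3p3 (R : realType) (g : lieAlgType (complex R))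
    (h b p : {vspace g}) (l : nat) (alpha : 'I_l -> dual h)
    (Z : 'I_l -> subvs_of h) (mu : dual h)
    (V : vectType (complex R))
    (rho : 'Hom(subvs_of (grade p alpha Z 0), 'End(V))) (phi0 : V) :
  is_semisimple g ->
  is_cartan h -> is_borel b -> is_parabolic p ->
  (h <= b)%VS -> (b <= p)%VS ->
  is_simple_system b alpha -> is_dual_basis alpha Z ->
  (forall s : {vspace g}, is_simple_ideal s -> ~~ (s <= grade p alpha Z 0)%VS) ->
  is_p_dominant p alpha (- mu) ->
  is_representation rho -> is_irreducible rho ->
  is_lowest_weight_vector rho b mu phi0 ->
  let gr := grade p alpha Z in
  let a := prolong gr (ann rho phi0) in
  let aplus := positive_part a in
  let I_p := Ip p alpha in
  let I_mu := Imu p alpha mu in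
  let J_mu := Jmu p alpha mu in
  (* (a) *)
  (forall k : nat, (0 < k)%N ->
     exists (n : nat) (beta : 'I_n -> dual h),
       [/\ injective beta, forall i, is_root (beta i),
           directv (\sum_(i < n) root_space (beta i))%VS
         & a k = (\sum_(i < n) root_space (beta i))%VS]) /\
  (* (b) *)
  (roots_of (a 1) = \bigcup_(i in [set` I_mu]) roots_1i0 p alpha Z mu i /\
   (I_mu = finset.set0 <-> aplus = [set 0])) /\
  (* (c) *)
  (I_mu <> finset.set0 ->
    [/\ lie_gen [set` a 1] = aplus,
        forall k : nat, (1 <= k)%N ->
          roots_of (a k) =
          [set beta | [/\ roots_of (gr k) beta, beta (ZS Z I_mu) = k%:R
                        & beta (ZS Z J_mu) = 0]]
      & forall k : nat, (1 <= k)%N ->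
          forall beta, roots_of (a k) beta ->
          forall j, j \in ((I_p :\: I_mu) :|: J_mu)%SET -> beta (Z j) = 0]).
Proof.
move=> ss cartan_h _ _ _ _ simple_alpha dualZ _ _ rep_rho _ low_phi.
have base := simple_system_base dualZ simple_alpha.
pose G := [set j | dual_form mu (alpha j) == 0]%SET.
have a0_gr := ann_gr0 rho phi0; have a0_sub := ann_subalgebra (phi := phi0) rep_rho.
have a0_h := hstable_ann cartan_h rep_rho low_phi.
have a0_neg := ann_negative ss cartan_h dualZ simple_alpha low_phi.
have a0_tvec := ann_tvec ss cartan_h dualZ low_phi.
have a0_simple := ann_simple ss cartan_h dualZ simple_alpha rep_rho low_phi.
move=> gr a aplus I_p I_mu J_mu.
(* With the next equation, the union of I_p minus I_mu and J_mu is exactly the complement of G. *)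
have I_muE i : (i \in I_mu) = (i \in I_p) && (i \in G).
  by rewrite !inE (dual_form_coroot_eq0 _ ss cartan_h dualZ) //; apply: base.1.
have J_muE i : (i \in J_mu) = (i \notin I_p) && (i \notin G).
  by rewrite !inE (dual_form_coroot_eq0 _ ss cartan_h dualZ) //; apply: base.1.
have rootsP (k : nat) beta : (0 < k)%N -> roots_of (a k) beta <->
    exists n, [/\ is_root beta, beta (ZS Z I_p) = k%:R, has_coords Z beta n
                & forall i, (0 < n i)%N -> i \in G].
  exact: (prolong_rootsP ss cartan_h dualZ base a0_gr a0_sub a0_h a0_neg a0_tvec a0_simple).
have gr_rootsP (k : nat) beta : (0 < k)%N -> roots_of (gr k) beta <->
    exists n, [/\ is_root beta, beta (ZS Z I_p) = k%:R & has_coords Z beta n].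
  move=> k0; split=> [[rb /subvP bk]|[n [rb bk nb]]]; last first.
    split; [exact: rb|apply/subvP => x bx].
    exact: (root_space_grading (j := k) bk bx).
  have [b0 +] := rb; rewrite -subv0 => /subvPn[x bx]; rewrite memv0 => x0.
  have bdeg := root_space_degree bx x0 (bk _ bx).
  have [n nb] := positive_degree_coords base rb k0 bdeg.
  by exists n.
have sum_eq0 (n : 'I_l -> nat) (S : {set 'I_l}) : (\sum_(i in S) n i = 0)%N ->
    forall i, i \in S -> n i = 0%N.
  by move=> /eqP; rewrite sum_nat_eq0 => /forallP nS i iS; have /implyP/(_ iS)/eqP := nS i.
have sum_gt0 (n : 'I_l -> nat) (S : {set 'I_l}) : (0 < \sum_(i in S) n i)%N ->
    exists2 i, i \in S & (0 < n i)%N.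
  rewrite lt0n sum_nat_eq0 negb_forall => /existsP[i ni]; exists i;
    by move: ni; rewrite negb_imply -lt0n => /andP[].
have sum_split (n : 'I_l -> nat) : (\sum_(i in I_p) n i =
    \sum_(i in I_mu) n i + \sum_(i in I_p :\: I_mu) n i)%N.
  rewrite (big_setID I_mu) /=; congr (_ + _)%N; apply: eq_bigl => i.
  by rewrite finset.in_setI I_muE; case: (i \in I_p).
have coordsE n beta i : has_coords Z beta n -> n i = 0%N -> beta (Z i) = 0.
  by move=> nb n0; rewrite nb n0.
have supportP n beta : has_coords Z beta n -> (forall i, (0 < n i)%N -> i \in G) ->
    forall i, i \in ((I_p :\: I_mu) :|: J_mu)%SET -> n i = 0%N.
  move=> nb nG i; case: (posnP (n i)) => // /nG iG.
  by rewrite finset.in_setU finset.in_setD I_muE J_muE iG; case: (i \in I_p).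
have degE n beta (S : {set 'I_l}) : has_coords Z beta n ->
    beta (ZS Z S) = (\sum_(i in S) n i)%N%:R by apply: degreeE.
have a_ind (k : nat) W : (0 < k)%N ->
    (forall beta : dual h, roots_of (a k) beta -> (root_space beta <= W)%VS) -> (a k <= W)%VS.
  exact: (prolong_ind ss cartan_h dualZ base a0_gr a0_sub a0_h a0_neg a0_tvec a0_simple).
split; last split.
- exact: (prolong_sum_root_spaces ss cartan_h dualZ base
    a0_gr a0_sub a0_h a0_neg a0_tvec a0_simple).
- split.
    apply/seteqP; split=> beta.
      move=> /(rootsP 1%N _ isT)[n [rb b1 nb nG]].
      move: b1; rewrite (degE n) // => /eqP; rewrite eqr_nat => /eqP n1.
      have [i iI ni] : exists2 i, i \in I_p & (0 < n i)%N by apply: sum_gt0; rewrite n1.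
      have ni1 : n i = 1%N.
        by move: n1; rewrite (bigD1 i) //=; case: (n i) ni => // -[|k].
      exists i; first by rewrite /= I_muE iI nG.
      split; last 1 first.
      + by move=> j jJ; apply: (coordsE n) => //; apply: (supportP n beta) => //;
        rewrite finset.in_setU jJ orbT.
      + by apply/(gr_rootsP 1%N _ isT); exists n; split=> //; rewrite (degE n) // n1.
      + by rewrite nb ni1.
    case=> i; rewrite /= I_muE => /andP[iI iG] [/(gr_rootsP 1%N _ isT)[n [rb b1 nb]] bi bJ].
    apply/(rootsP 1%N _ isT); exists n; split=> // j nj.
    (* An index j outside G would either lie in J_mu, against [bJ], or be a second index of I_p
       besides i, making the degree at least 2. *)
    apply: contraT => jG; have [jI|jI] := boolP (j \in I_p); last first.
      have := bJ j; rewrite J_muE jI jG nb => /(_ isT)/eqP; rewrite pnatr_eq0.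
      by rewrite eqn0Ngt nj.
    have ij : j != i by apply: contraNneq jG => ->.
    move: b1 bi; rewrite (degE n) // nb => /eqP + /eqP; rewrite eqr_nat (pnatr_eq1 _ (n i)).
    rewrite (bigD1 i) //= (bigD1 j) /= ?jI // => + /eqP ni; rewrite ni.
    by case: (n j) nj.
  split=> [I0|ap0].
    have a_eq0 (k : nat) : (0 < k)%N -> (a k <= 0)%VS.
      move=> k0; apply: a_ind => // beta /(rootsP _ _ k0)[n [rb bk nb nG]].
      move: bk; rewrite (degE n) // => /eqP; rewrite eqr_nat => /eqP nk.
      have [i iI /nG iG] : exists2 i, i \in I_p & (0 < n i)%N by apply: sum_gt0; rewrite nk.
      have : i \in I_mu by rewrite I_muE iI iG.
      by rewrite I0 inE.
    apply/seteqP; split=> [x [n]|_ ->]; last by exists 0%N; rewrite mem0v.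
    rewrite big_seq => xs; apply/eqP; rewrite -memv0; move: x xs; apply/subvP.
    apply: (big_ind (fun U => (U <= 0)%VS)) => [|U W|k]; first exact: subvv.
      by rewrite subv_add => -> ->.
    by rewrite mem_index_iota => /andP[k0 _]; apply: a_eq0.
  apply/eqP/finset.set0Pn; case=> i; rewrite I_muE => /andP[iI iG].
  have := simple_prolong ss cartan_h dualZ base a0_neg a0_tvec a0_simple iG; rewrite -/I_p iI.
  have [_ +] := base.1 i; rewrite -subv0 => /subvPn[x ix]; rewrite memv0 => /eqP x0.
  move=> /subvP/(_ x ix) xa; apply: x0.
  suff : aplus x by rewrite ap0.
  (* The upper bound is exclusive, so the partial sum is [a 1]. *)
  by exists 2%N; rewrite big_nat1.
move=> _; split.
- exact: (lie_gen_prolong ss cartan_h dualZ base a0_gr a0_sub a0_h a0_neg a0_tvec a0_simple).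
- move=> k k0; apply/seteqP; split=> beta.
    move=> /(rootsP _ _ k0)[n [rb bk nb nG]]; split.
    + by apply/(gr_rootsP _ _ k0); exists n.
    + rewrite -bk !(degE n) // sum_split [X in (_ + X)%N]big1 ?addn0 // => i iS.
      by apply: (supportP n beta) => //; rewrite finset.in_setU iS.
    + rewrite (degE n) // big1 // => i iJ.
      by apply: (supportP n beta) => //; rewrite finset.in_setU iJ orbT.
  case=> /(gr_rootsP _ _ k0)[n [rb bk nb]] bI bJ; apply/(rootsP _ _ k0).
  exists n; split=> // i ni; apply: contraT => iG.
  move: bk bI bJ; rewrite !(degE n) // => /eqP + /eqP + /eqP.
  rewrite !eqr_nat pnatr_eq0 => /eqP nk /eqP nI /eqP nJ.
  (* The coefficients over I_p and over I_mu both sum to k, so those in between, being natural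
     numbers, all vanish. *)
  have n0 : (\sum_(i in I_p :\: I_mu) n i = 0)%N.
    by apply/eqP; rewrite -(eqn_add2l k) addn0 -{1}nI -sum_split nk.
  have [iI|iI] := boolP (i \in I_p).
    by move: ni; rewrite (sum_eq0 _ _ n0) // finset.in_setD I_muE iI (negPf iG).
  by move: ni; rewrite (sum_eq0 _ _ nJ) // J_muE iI iG.
move=> k k0 beta /(rootsP _ _ k0)[n [_ _ nb nG]] j jS.
by apply: (coordsE n) => //; apply: (supportP n beta).
Qed.
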